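(* For every non-empty finite subset $S$ of $\mathbb{Z}^+$, the variety $\mathbb{V}(\{\mathbf{F}_k(\mathbb{Z}) : k\in S\})$ is axiomatized, relative to the variety $\mathsf{DLP}$ of distributive $\ell$-pregroups, by the single $4|S|$-variable equation \[ 1 \le \bigvee_{k\in S} w_k\big[\, z_k^{\ell^{2k}} z_k^{\ell} \,\wedge\, \sigma_k(y_k)^k\, x_k\, \sigma_k(y_k)^{-k}\, x_k^{\ell}\,\big]w_k^{\ell}, \] where $x_k,y_k,z_k,w_k$ ($k\in S$) are pairwise distinct variables.
   Context: An $\ell$-pregroup is an algebra $(A,\wedge,\vee,\cdot,1,{}^{\ell},{}^{r})$ such that $(A,\wedge,\vee)$ is a lattice, $(A,\cdot,1)$ is a monoid, multiplication is order-preserving in both arguments, and $a^{\ell}a\le 1\le aa^{\ell}$ and $aa^{r}\le 1\le a^{r}a$ for all $a\in A$. It is distributive if its lattice reduct is distributive; $\mathsf{DLP}$ is the variety of distributive $\ell$-pregroups. Write $x^{\ell^k}$, $x^{r^k}$ for the $k$-fold application of ${}^\ell$, ${}^r$. For $k\ge 0$ let $x^{[k]}:=x^{\ell^{2k}}$, and $\sigma_k(x):=x\wedge x^{[1]}\wedge\dots\wedge x^{[k-1]}$. The expression $\sigma_k(y)^{-k}$ stands for the term $(\sigma_k(y)^{k})^{\ell}$. An inequality $s\le t$ is read as the equation $s\approx s\wedge t$. $\mathbf{F}(\mathbb{Z})$ is the $\ell$-pregroup of all order-preserving maps $f\colon\mathbb{Z}\to\mathbb{Z}$ such that $f^{-1}[\{x\}]$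 is finite for every $x\in\mathbb{Z}$, with composition as multiplication, the identity map as $1$, the pointwise order, and $f^{\ell}(q)=\min\{p: q\le f(p)\}$, $f^{r}(q)=\max\{p: f(p)\le q\}$. $\mathbf{F}_n(\mathbb{Z})$ is the subalgebra of all $f$ with $f^{\ell^n}=f^{r^n}$; equivalently, all $f\in \mathbf{F}(\mathbb{Z})$ with $f(x+n)=f(x)+n$ for all $x\in\mathbb{Z}$. $\mathbb{V}(\mathcal{K})$ denotes the variety generated by $\mathcal{K}$. *)

(* Defs.v *)
From mathcomp Require Import all_boot all_order all_algebra finmap.
From mathcomp Require Import boolp classical_sets functions cardinality.
From mathcomp Require Import zify.

Set Implicit Arguments.
Unset Strict Implicit.
Unset Printing Implicit Defensive.

Import Order.TTheory GRing.Theory Num.Theory.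
Local Open Scope classical_set_scope.
Local Open Scope ring_scope.

(* Algebras, with no laws assumed, in the signature of l-pregroups;
   [ladj a] is a^l and [radj a] is a^r. *)
Record algebra := Algebra {
  carrier :> Type;
  meet : carrier -> carrier -> carrier;
  join : carrier -> carrier -> carrier;
  mul : carrier -> carrier -> carrier;
  one : carrier;
  ladj : carrier -> carrier;
  radj : carrier -> carrier }.

Arguments one {a}.

Definition le (A : algebra) (a b : A) : Prop := a = meet a b.

Record is_lpregroup (A : algebra) : Prop := {
  meetA_ax : associative (@meet A);
  meetC_ax : commutative (@meet A);
  joinA_ax : associative (@join A);
  joinC_ax : commutative (@join A);
  meetKU_ax : forall a b : A, meet a (join a b) = a;
  joinKI_ax : forall a b : A, join a (meet a b) = a;
  mulA_ax : associative (@mul A);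
  mul1_ax : left_id one (@mul A);
  mulr1_ax : right_id one (@mul A);
  le_mul_ax : forall a b c d : A, le a b -> le c d -> le (mul a c) (mul b d);
  ladj_le1_ax : forall a : A, le (mul (ladj a) a) one;
  ladj_ge1_ax : forall a : A, le one (mul a (ladj a));
  radj_le1_ax : forall a : A, le (mul a (radj a)) one;
  radj_ge1_ax : forall a : A, le one (mul (radj a) a) }.

Definition DLP : set algebra :=
  [set A | is_lpregroup A /\ left_distributive (@meet A) (@join A)].

(* A fixed countably infinite supply of variables, arranged in four families
   indexed by nat. *)
Inductive var : Type := vx of nat | vy of nat | vz of nat | vw of nat.

Inductive term : Type :=
  | tvar of var
  | tmeet of term & term
  | tjoin of term & term
  | tmul of term & term
  | tone
  | tladj of term
  | tradj of term.

Fixpoint eval (A : algebra) (v : var -> A) (t : term) : A :=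
  match t with
  | tvar x => v x
  | tmeet s t => meet (eval v s) (eval v t)
  | tjoin s t => join (eval v s) (eval v t)
  | tmul s t => mul (eval v s) (eval v t)
  | tone => one
  | tladj t => ladj (eval v t)
  | tradj t => radj (eval v t)
  end.

Definition equation : Type := (term * term)%type.

Definition satisfies (A : algebra) (e : equation) : Prop :=
  forall v : var -> A, eval v e.1 = eval v e.2.

Definition models (E : set equation) : set algebra :=
  [set A | forall e, E e -> satisfies A e].

Definition is_variety (V : set algebra) : Prop :=
  exists E : set equation, V = models E.

Definition generated_variety (K : set algebra) : set algebra :=
  \bigcap_(V in [set V | is_variety V /\ K `<=` V]) V.

Definition tleq (s t : term) : equation := (s, tmeet s t).

Definition texp (t : term) (k : nat) : term := iterop k tmul t tone.

Definition tshift (k : nat) (t : term) : term := iter (2 * k) tladj t.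

(* For k >= 1; sigma 0 t is the junk value t. *)
Definition sigma (k : nat) (t : term) : term :=
  foldl (fun s j => tmeet s (tshift j t)) t (iota 1 k.-1).

(* Join of a nonempty list of terms; the empty list gets the junk value 1. *)
Definition tbigjoin (ts : seq term) : term :=
  if ts is t :: ts' then foldl tjoin t ts' else tone.

(* The negative power sigma_k(y)^{-k} abbreviates (sigma_k(y)^k)^l. *)
Definition summand (k : nat) : term :=
  let x := tvar (vx k) in let y := tvar (vy k) in
  let z := tvar (vz k) in let w := tvar (vw k) in
  let s := texp (sigma k y) k in
  tmul
    (tmul w
       (tmeet (tmul (iter (2 * k) tladj z) (tladj z))
              (tmul (tmul (tmul s x) (tladj s)) (tladj x))))
    (tladj w).

Definition join_equation (S : {fset nat}) : equation :=
  tleq tone (tbigjoin [seq summand k | k <- enum_fset S]).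

Record subuniverse (A : algebra) (P : set A) : Prop := {
  sub_meet : forall a b, P a -> P b -> P (meet a b);
  sub_join : forall a b, P a -> P b -> P (join a b);
  sub_mul : forall a b, P a -> P b -> P (mul a b);
  sub_one : P one;
  sub_ladj : forall a, P a -> P (ladj a);
  sub_radj : forall a, P a -> P (radj a) }.

Definition subalgebra (A : algebra) (P : set A) (HP : subuniverse P) :
    algebra :=
  @Algebra {a : A | P a}
    (fun a b => exist P _ (sub_meet HP (svalP a) (svalP b)))
    (fun a b => exist P _ (sub_join HP (svalP a) (svalP b)))
    (fun a b => exist P _ (sub_mul HP (svalP a) (svalP b)))
    (exist P _ (sub_one HP))
    (fun a => exist P _ (sub_ladj HP (svalP a)))
    (fun a => exist P _ (sub_radj HP (svalP a))).

Definition is_FZ (f : int -> int) : Prop :=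
  {homo f : x y / x <= y} /\ forall x, finite_set (f @^-1` [set x]).

Definition is_min (P : set int) (m : int) : Prop := P m /\ lbound P m.
Definition is_max (P : set int) (m : int) : Prop := P m /\ ubound P m.

(* The default value 0 of [xget] is never used when [is_FZ f]:
   see [ladj_funP] and [radj_funP]. *)
Definition ladj_fun (f : int -> int) (q : int) : int :=
  xget 0 [set m | is_min [set p | q <= f p] m].
Definition radj_fun (f : int -> int) (q : int) : int :=
  xget 0 [set m | is_max [set p | f p <= q] m].

Definition meet_fun (f g : int -> int) (x : int) : int :=
  Order.min (f x) (g x).
Definition join_fun (f g : int -> int) (x : int) : int :=
  Order.max (f x) (g x).

Lemma finite_bounded (P : set int) :
  finite_set P -> exists M : nat, forall x, P x -> (`|x| <= M)%N.
Proof.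
move=> /finite_seqP[s ->]; exists (\max_(x <- s) `|x|%N) => x /= xs.
exact: (leq_bigmax_seq x).
Qed.

Lemma interval_finite (P : set int) (a b : int) :
  (forall x, P x -> a < x < b) -> finite_set P.
Proof.
move=> Pab; apply: (@sub_finite_set _ _
  [set a + n%:Z | n in `I_`|b - a|%N]); last first.
  exact/finite_image/finite_II.
move=> x /Pab axb; exists `|x - a|%N => /=; lia.
Qed.

Lemma is_FZP (f : int -> int) : is_FZ f <->
  [/\ {homo f : x y / x <= y}, forall q, exists p, q <= f p
    & forall q, exists p, f p <= q].
Proof.
split=> [[fh ff]|[fh fu fl]]; split=> //.
- have up p : exists p', f p + 1 <= f p'.
    have [M HM] := finite_bounded (ff (f p)).
    exists (p + `|p|%:Z + M%:Z + 1).
    have := fh p (p + `|p|%:Z + M%:Z + 1) ltac:(lia).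
    have : f (p + `|p|%:Z + M%:Z + 1) <> f p.
      by move=> /HM; lia.
    lia.
  have upn (n : nat) : exists p, f 0 + n%:Z <= f p.
    elim: n => [|n [p pn]]; first by exists 0; lia.
    by have [p' p'n] := up p; exists p'; lia.
  move=> q; have [p Hp] := upn (absz (q - f 0)%R); exists p; lia.
- have dn p : exists p', f p' + 1 <= f p.
    have [M HM] := finite_bounded (ff (f p)).
    exists (p - `|p|%:Z - M%:Z - 1).
    have := fh (p - `|p|%:Z - M%:Z - 1) p ltac:(lia).
    have : f (p - `|p|%:Z - M%:Z - 1) <> f p.
      by move=> /HM; lia.
    lia.
  have dnn (n : nat) : exists p, f p + n%:Z <= f 0.
    elim: n => [|n [p pn]]; first by exists 0; lia.
    by have [p' p'n] := dn p; exists p'; lia.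
  by move=> q; have [p Hp] := dnn (absz (q - f 0)%R); exists p; lia.
- move=> x; have [a Ha] := fl (x - 1); have [b Hb] := fu (x + 1).
  apply: (@interval_finite _ a b) => y /= fy.
  have [/fh|ay] := leP y a; first lia.
  by have [/fh|yb] := leP b y; lia.
Qed.

Lemma min_exists (P : set int) (a : int) :
  P !=set0 -> lbound P a -> exists m, is_min P m.
Proof.
move=> [b Pb] aP.
have ex : exists n : nat, `[< P (a + n%:Z) >].
  exists `|b - a|%N; apply/asboolP; have ab : a <= b := aP _ Pb.
  by rewrite (_ : a + _ = b) //; lia.
case: (ex_minnP ex) => n /asboolP Pn nmin; exists (a + n%:Z); split=> // x Px.
have ax : a <= x := aP _ Px; have := nmin `|x - a|%N.
rewrite (_ : a + `|x - a|%N = x); last lia.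
by move=> /(_ (asboolT Px)); lia.
Qed.

Lemma max_exists (P : set int) (a : int) :
  P !=set0 -> ubound P a -> exists m, is_max P m.
Proof.
move=> [b Pb] aP.
have [||m [Pm mP]] := @min_exists [set - x | x in P] (- a).
- by exists (- b); exists b.
- by move=> _ [x /aP xa <-]; rewrite lerN2.
- case: Pm mP => x Px <- mP; exists x; split=> // y Py.
  by have := mP (- y) (ex_intro2 _ _ y Py erefl); rewrite lerN2.
Qed.

Lemma ladj_funP (f : int -> int) (q : int) :
  is_FZ f -> is_min [set p | q <= f p] (ladj_fun f q).
Proof.
move=> /is_FZP[fh fu fl].
apply: (xgetPex 0 (P := [set m | is_min [set p | q <= f p] m])).
have [a Ha] := fl (q - 1); apply: (@min_exists _ a); first exact: fu.
by move=> x /= Hx; have [//|/ltW/fh] := leP a x; lia.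
Qed.

Lemma radj_funP (f : int -> int) (q : int) :
  is_FZ f -> is_max [set p | f p <= q] (radj_fun f q).
Proof.
move=> /is_FZP[fh fu fl].
apply: (xgetPex 0 (P := [set m | is_max [set p | f p <= q] m])).
have [a Ha] := fu (q + 1); apply: (@max_exists _ a); first exact: fl.
by move=> x /= Hx; have [//|/ltW/fh] := leP x a; lia.
Qed.

Lemma ladj_galois (f : int -> int) (q p : int) :
  is_FZ f -> (ladj_fun f q <= p) = (q <= f p).
Proof.
move=> Ff; have [/= h1 h2] := ladj_funP q Ff; apply/idP/idP => [|/h2//].
by move=> /(Ff.1); apply: le_trans.
Qed.

Lemma radj_galois (f : int -> int) (q p : int) :
  is_FZ f -> (p <= radj_fun f q) = (f p <= q).
Proof.
move=> Ff; have [/= h1 h2] := radj_funP q Ff; apply/idP/idP => [|/h2//].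
by move=> /(Ff.1) /le_trans; apply.
Qed.

Lemma is_FZ_id : is_FZ id.
Proof. by apply/is_FZP; split=> // q; exists q. Qed.

Lemma is_FZ_comp f g : is_FZ f -> is_FZ g -> is_FZ (f \o g).
Proof.
move=> /is_FZP[fh fu fl] /is_FZP[gh gu gl]; apply/is_FZP; split=> [x y|q|q].
- by move=> /gh /fh.
- by have [p qp] := fu q; have [r /fh pr] := gu p; exists r; apply: le_trans pr.
- by have [p qp] := fl q; have [r /fh pr] := gl p; exists r; apply: le_trans qp.
Qed.

Lemma is_FZ_meet f g : is_FZ f -> is_FZ g -> is_FZ (meet_fun f g).
Proof.
move=> /is_FZP[fh fu fl] /is_FZP[gh gu gl]; rewrite /meet_fun.
apply/is_FZP; split=> [x y xy|q|q].
- by have := fh _ _ xy; have := gh _ _ xy; lia.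
- have [p qp] := fu q; have [r pr] := gu q; exists (Order.max p r).
  have := fh p (Order.max p r) ltac:(lia).
  by have := gh r (Order.max p r) ltac:(lia); lia.
- by have [p qp] := fl q; exists p; lia.
Qed.

Lemma is_FZ_join f g : is_FZ f -> is_FZ g -> is_FZ (join_fun f g).
Proof.
move=> /is_FZP[fh fu fl] /is_FZP[gh gu gl]; rewrite /join_fun.
apply/is_FZP; split=> [x y xy|q|q].
- by have := fh _ _ xy; have := gh _ _ xy; lia.
- by have [p qp] := fu q; exists p; lia.
- have [p qp] := fl q; have [r pr] := gl q; exists (Order.min p r).
  have := fh (Order.min p r) p ltac:(lia).
  by have := gh (Order.min p r) r ltac:(lia); lia.
Qed.

Lemma is_FZ_ladj f : is_FZ f -> is_FZ (ladj_fun f).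
Proof.
move=> Ff; apply/is_FZP; split=> [x y xy|q|q].
- by rewrite ladj_galois // (le_trans xy) // -ladj_galois.
- exists (f q + 1); rewrite leNgt; apply/negP => h.
  have : ladj_fun f (f q + 1) <= q by lia.
  by rewrite ladj_galois //; lia.
- by exists (f q); rewrite ladj_galois.
Qed.

Lemma is_FZ_radj f : is_FZ f -> is_FZ (radj_fun f).
Proof.
move=> Ff; apply/is_FZP; split=> [x y xy|q|q].
- by rewrite radj_galois // (le_trans _ xy) // -radj_galois.
- by exists (f q); rewrite radj_galois.
- exists (f q - 1); rewrite leNgt; apply/negP => h.
  have : q <= radj_fun f (f q - 1) by lia.
  by rewrite radj_galois //; lia.
Qed.

Definition FZ : algebra :=
  @Algebra {f : int -> int | is_FZ f}
    (fun f g => exist is_FZ _ (is_FZ_meet (svalP f) (svalP g)))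
    (fun f g => exist is_FZ _ (is_FZ_join (svalP f) (svalP g)))
    (fun f g => exist is_FZ _ (is_FZ_comp (svalP f) (svalP g)))
    (exist is_FZ _ is_FZ_id)
    (fun f => exist is_FZ _ (is_FZ_ladj (svalP f)))
    (fun f => exist is_FZ _ (is_FZ_radj (svalP f))).

Lemma FZ_ext_ge (f g : FZ) :
  (forall q p, (sval f q <= p) = (sval g q <= p)) -> f = g.
Proof.
case: f g => [f Ff] [g Fg] /= fg; apply: eq_exist; apply: funext => q.
by apply/eqP; rewrite eq_le fg lexx -fg lexx.
Qed.

Lemma FZ_ext_le (f g : FZ) :
  (forall q p, (p <= sval f q) = (p <= sval g q)) -> f = g.
Proof.
case: f g => [f Ff] [g Fg] /= fg; apply: eq_exist; apply: funext => q.
by apply/eqP; rewrite eq_le -fg lexx fg lexx.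
Qed.

Lemma FZ_ladj_galois (f : FZ) q p :
  (sval (ladj f) q <= p) = (q <= sval f p).
Proof. by apply: ladj_galois; apply: svalP. Qed.

Lemma FZ_radj_galois (f : FZ) q p :
  (p <= sval (radj f) q) = (sval f p <= q).
Proof. by apply: radj_galois; apply: svalP. Qed.

Lemma FZ_ladjK : cancel (@ladj FZ) (@radj FZ).
Proof.
by move=> f; apply: FZ_ext_le => q p; rewrite FZ_radj_galois FZ_ladj_galois.
Qed.

Lemma FZ_radjK : cancel (@radj FZ) (@ladj FZ).
Proof.
by move=> f; apply: FZ_ext_ge => q p; rewrite FZ_ladj_galois FZ_radj_galois.
Qed.

Lemma FZ_ladj1 : ladj one = one :> FZ.
Proof. by apply: FZ_ext_ge => q p; rewrite FZ_ladj_galois. Qed.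

Lemma FZ_radj1 : radj one = one :> FZ.
Proof. by apply: FZ_ext_le => q p; rewrite FZ_radj_galois. Qed.

Lemma FZ_ladj_mul (f g : FZ) : ladj (mul f g) = mul (ladj g) (ladj f).
Proof.
apply: FZ_ext_ge => q p; rewrite FZ_ladj_galois [in RHS]/=.
by rewrite (FZ_ladj_galois g) (FZ_ladj_galois f).
Qed.

Lemma FZ_radj_mul (f g : FZ) : radj (mul f g) = mul (radj g) (radj f).
Proof.
apply: FZ_ext_le => q p; rewrite FZ_radj_galois [in RHS]/=.
by rewrite (FZ_radj_galois g) (FZ_radj_galois f).
Qed.

Lemma FZ_ladj_meet (f g : FZ) : ladj (meet f g) = join (ladj f) (ladj g).
Proof.
apply: FZ_ext_ge => q p; rewrite FZ_ladj_galois /= /join_fun /meet_fun.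
by rewrite ge_max le_min (FZ_ladj_galois f) (FZ_ladj_galois g).
Qed.

Lemma FZ_ladj_join (f g : FZ) : ladj (join f g) = meet (ladj f) (ladj g).
Proof.
apply: FZ_ext_ge => q p; rewrite FZ_ladj_galois /= /join_fun /meet_fun.
by rewrite ge_min le_max (FZ_ladj_galois f) (FZ_ladj_galois g).
Qed.

Lemma FZ_radj_meet (f g : FZ) : radj (meet f g) = join (radj f) (radj g).
Proof.
apply: FZ_ext_le => q p; rewrite FZ_radj_galois /= /join_fun /meet_fun.
by rewrite le_max ge_min (FZ_radj_galois f) (FZ_radj_galois g).
Qed.

Lemma FZ_radj_join (f g : FZ) : radj (join f g) = meet (radj f) (radj g).
Proof.
apply: FZ_ext_le => q p; rewrite FZ_radj_galois /= /join_fun /meet_fun.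
by rewrite le_min ge_max (FZ_radj_galois f) (FZ_radj_galois g).
Qed.

Lemma FZ_iter_adj (n : nat) (f g : FZ) :
  [/\ iter n (@ladj FZ) (meet f g) =
        (if odd n then @join FZ else @meet FZ) (iter n (@ladj FZ) f) (iter n (@ladj FZ) g),
      iter n (@ladj FZ) (join f g) =
        (if odd n then @meet FZ else @join FZ) (iter n (@ladj FZ) f) (iter n (@ladj FZ) g)
    & iter n (@ladj FZ) (mul f g) =
        if odd n then mul (iter n (@ladj FZ) g) (iter n (@ladj FZ) f)
        else mul (iter n (@ladj FZ) f) (iter n (@ladj FZ) g)] /\
  [/\ iter n (@radj FZ) (meet f g) =
        (if odd n then @join FZ else @meet FZ) (iter n (@radj FZ) f) (iter n (@radj FZ) g),
      iter n (@radj FZ) (join f g) =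
        (if odd n then @meet FZ else @join FZ) (iter n (@radj FZ) f) (iter n (@radj FZ) g)
    & iter n (@radj FZ) (mul f g) =
        if odd n then mul (iter n (@radj FZ) g) (iter n (@radj FZ) f)
        else mul (iter n (@radj FZ) f) (iter n (@radj FZ) g)].
Proof.
elim: n => [//|n [[h1 h2 h3] [h4 h5 h6]]].
rewrite !iterS h1 h2 h3 h4 h5 h6 [odd n.+1]/=.
by case: (odd n); rewrite [~~ _]/= !(FZ_ladj_meet, FZ_ladj_join, FZ_ladj_mul,
  FZ_radj_meet, FZ_radj_join, FZ_radj_mul).
Qed.

Definition is_Fn (n : nat) : set FZ :=
  [set f : FZ | iter n (@ladj FZ) f = iter n (@radj FZ) f].

Lemma is_Fn_subuniverse (n : nat) : subuniverse (is_Fn n).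
Proof.
split=> [f g|f g|f g||f|f]; rewrite /is_Fn /mkset.
- by have [[-> _ _] [-> _ _]] := FZ_iter_adj n f g => -> ->.
- by have [[_ -> _] [_ -> _]] := FZ_iter_adj n f g => -> ->.
- by have [[_ _ ->] [_ _ ->]] := FZ_iter_adj n f g => -> ->.
- have [-> ->//] : iter n (@ladj FZ) one = one /\ iter n (@radj FZ) one = one.
  by elim: n => // n [IHl IHr]; rewrite !iterS IHl IHr FZ_ladj1 FZ_radj1.
- rewrite -(iterSr n (@ladj FZ)) iterS => ->; case: n => [//|n].
  by rewrite iterS (iterSr n (@radj FZ) (ladj f)) FZ_radjK FZ_ladjK.
- rewrite -(iterSr n (@radj FZ)) iterS => <-; case: n => [//|n].
  by rewrite (iterSr n (@ladj FZ) (radj f)) FZ_radjK iterS FZ_ladjK.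
Qed.

Definition Fn (n : nat) : algebra := subalgebra (is_Fn_subuniverse n).

(* Main.v *)
Require Import Defs.
From HB Require Import structures.
From mathcomp Require Import all_boot all_order all_algebra finmap.
From mathcomp Require Import boolp classical_sets functions cardinality.
From mathcomp Require Import zify.
Import Defs.

(* That the bracket of index [k] is always at least 1 means that the algebra is
   [k]-periodic and that [k]-th powers of its invertible elements are central.
   For [A] in DLP and [~ s <= t], a prime filter separating [s] from [t] yields
   an action of [A] on a chain in which [s] moves some point beyond [t]; the
   conjugating variables [w_k] make a single bracket [k] valid in this action.
   In a faithful action of that kind the group [H] of invertible elements is
   abelian, because a finite-order automorphism of a chain is trivial, and for
   the same reason conjugation by [h] in [H] is an iterate of [x |-> x^ll].
   If [x |-> x^ll] is not the identity, a pair [x p < x^ll p] is a covering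
   pair, from which one gets [T] in [H] mapping each point to its cover; then
   [H] is transitive and the chain is an ordered abelian group with least
   positive element [T], on which each [x] acts as [u |-> u + s + e(u) T], with
   [e(u)] depending only on a residue of [u] modulo [k].  Finitely many sign
   conditions in such a group can be realized by a map to the integers sending
   [T] to 1 and respecting the residues (Elliott: totally ordered groups are
   ultrasimplicial), so an evaluation in [A] is copied into F_k(Z). *)

Set Implicit Arguments.
Unset Strict Implicit.
Unset Printing Implicit Defensive.

Local Open Scope classical_set_scope.

Local Infix "**" := mul (at level 40, left associativity).
Local Infix "<==" := le (at level 70).

(** * Calculus of l-pregroups *)

(* [x^[1]] in the notation of the statement. *)
Definition shift (A : algebra) (a : A) : A := ladj (ladj a).

Definition pow (A : algebra) (a : A) (n : nat) : A := iter n (mul a) one.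

Fixpoint bmeet (A : algebra) (f : nat -> A) (n : nat) : A :=
  if n is n'.+1 then meet (bmeet f n') (f n) else f 0.

Fixpoint bjoin (A : algebra) (f : nat -> A) (n : nat) : A :=
  if n is n'.+1 then join (bjoin f n') (f n) else f 0.

Section LPregroup.

Variable A : algebra.
Hypothesis lpA : is_lpregroup A.
Implicit Types a b c x y z h : A.

Lemma lp_meetxx a : meet a a = a.
Proof. by rewrite -{2}(joinKI_ax lpA a a) (meetKU_ax lpA). Qed.

Lemma lp_refl a : a <== a.
Proof. by rewrite /le lp_meetxx. Qed.

Lemma lp_trans b a c : a <== b -> b <== c -> a <== c.
Proof. by rewrite /le => -> {1}->; rewrite (meetA_ax lpA). Qed.

Lemma lp_anti a b : a <== b -> b <== a -> a = b.
Proof. by move=> ab ba; rewrite ab (meetC_ax lpA) -ba. Qed.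

Lemma lp_meetl a b : meet a b <== a.
Proof. by rewrite /le (meetC_ax lpA _ a) (meetA_ax lpA) lp_meetxx. Qed.

Lemma lp_meetr a b : meet a b <== b.
Proof. by rewrite /le -(meetA_ax lpA) lp_meetxx. Qed.

Lemma lp_glb a b c : c <== a -> c <== b -> c <== meet a b.
Proof. by rewrite /le (meetA_ax lpA) => <- <-. Qed.

Lemma lp_joinl a b : a <== join a b.
Proof. by rewrite /le (meetKU_ax lpA). Qed.

Lemma lp_joinr a b : b <== join a b.
Proof. by rewrite (joinC_ax lpA); exact: lp_joinl. Qed.

Lemma lp_leEjoin a b : a <== b <-> join a b = b.
Proof.
rewrite /le; split => [->|<-]; last by rewrite (meetKU_ax lpA).
by rewrite (joinC_ax lpA) (meetC_ax lpA) (joinKI_ax lpA).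
Qed.

Lemma lp_lub a b c : a <== c -> b <== c -> join a b <== c.
Proof.
by move=> /lp_leEjoin ac /lp_leEjoin bc; apply/lp_leEjoin; rewrite -(joinA_ax lpA) bc.
Qed.

Lemma lp_mul2 a b c d : a <== b -> c <== d -> a ** c <== b ** d.
Proof. exact: (le_mul_ax lpA). Qed.

Lemma lp_mul2l a b c : b <== c -> a ** b <== a ** c.
Proof. by move=> bc; apply: lp_mul2 => //; exact: lp_refl. Qed.

Lemma lp_mul2r a b c : b <== c -> b ** a <== c ** a.
Proof. by move=> bc; apply: lp_mul2 => //; exact: lp_refl. Qed.

Lemma lp_mulA a b c : a ** (b ** c) = a ** b ** c.
Proof. exact: (mulA_ax lpA). Qed.

Lemma lp_mul1 a : one ** a = a.
Proof. exact: (mul1_ax lpA). Qed.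

Lemma lp_mulr1 a : a ** one = a.
Proof. exact: (mulr1_ax lpA). Qed.

(** The inequalities [1 <= a a^l] and [a^l a <= 1] are the unit and counit of an adjunction. With
    the next three laws, identities reduce to rewriting inequalities against an arbitrary [c]. *)
Lemma lp_ladjP a b c : ladj a ** c <== b <-> c <== a ** b.
Proof.
split => h.
  apply: (lp_trans (b := a ** ladj a ** c)).
    by rewrite -{1}(lp_mul1 c); apply/lp_mul2r/(ladj_ge1_ax lpA).
  by rewrite -lp_mulA; apply: lp_mul2l.
apply: (lp_trans (b := ladj a ** a ** b)).
  by rewrite -lp_mulA; apply: lp_mul2l.
by rewrite -{2}(lp_mul1 b); apply/lp_mul2r/(ladj_le1_ax lpA).
Qed.

Lemma lp_radjP a b c : a ** b <== c <-> b <== radj a ** c.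
Proof.
split => h.
  apply: (lp_trans (b := radj a ** a ** b)).
    by rewrite -{1}(lp_mul1 b); apply/lp_mul2r/(radj_ge1_ax lpA).
  by rewrite -lp_mulA; apply: lp_mul2l.
apply: (lp_trans (b := a ** radj a ** c)).
  by rewrite -lp_mulA; apply: lp_mul2l.
by rewrite -{2}(lp_mul1 c); apply/lp_mul2r/(radj_le1_ax lpA).
Qed.

Lemma lp_ladjPr a b c : b ** a <== c <-> b <== c ** ladj a.
Proof.
split => h.
  apply: (lp_trans (b := b ** (a ** ladj a))).
    by rewrite -{1}(lp_mulr1 b); apply/lp_mul2l/(ladj_ge1_ax lpA).
  by rewrite lp_mulA; apply: lp_mul2r.
apply: (lp_trans (b := c ** (ladj a ** a))).
  by rewrite lp_mulA; apply: lp_mul2r.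
by rewrite -{2}(lp_mulr1 c); apply/lp_mul2l/(ladj_le1_ax lpA).
Qed.

Lemma lp_radjPr a b c : c ** radj a <== b <-> c <== b ** a.
Proof.
split => h.
  apply: (lp_trans (b := c ** (radj a ** a))).
    by rewrite -{1}(lp_mulr1 c); apply/lp_mul2l/(radj_ge1_ax lpA).
  by rewrite lp_mulA; apply: lp_mul2r.
apply: (lp_trans (b := b ** (a ** radj a))).
  by rewrite lp_mulA; apply: lp_mul2r.
by rewrite -{2}(lp_mulr1 b); apply/lp_mul2l/(radj_le1_ax lpA).
Qed.

Lemma lp_eq_le a b : (forall c, c <== a <-> c <== b) -> a = b.
Proof. by move=> h; apply: lp_anti; apply/h; exact: lp_refl. Qed.

Lemma lp_eq_ge a b : (forall c, a <== c <-> b <== c) -> a = b.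
Proof. by move=> h; apply: lp_anti; apply/h; exact: lp_refl. Qed.

Lemma lp_le_meet a b c : c <== meet a b <-> c <== a /\ c <== b.
Proof.
split=> [h|[]]; last exact: lp_glb.
by split; apply: lp_trans h _; [exact: lp_meetl|exact: lp_meetr].
Qed.

Lemma lp_join_le a b c : join a b <== c <-> a <== c /\ b <== c.
Proof.
split=> [h|[]]; last exact: lp_lub.
by split; apply: lp_trans h; [exact: lp_joinl|exact: lp_joinr].
Qed.

(** Right multiplication by [c] is right adjoint to right multiplication by [radj c], hence
    preserves meets. The other three adjunctions give the next three lemmas. *)
Lemma lp_mulIr a b c : meet a b ** c = meet (a ** c) (b ** c).
Proof.
by apply: lp_eq_le => d; rewrite lp_le_meet -!lp_radjPr lp_le_meet.
Qed.

Lemma lp_mulIl a b c : c ** meet a b = meet (c ** a) (c ** b).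
Proof.
by apply: lp_eq_le => d; rewrite lp_le_meet -!lp_ladjP lp_le_meet.
Qed.

Lemma lp_mulUr a b c : join a b ** c = join (a ** c) (b ** c).
Proof.
by apply: lp_eq_ge => d; rewrite lp_join_le !lp_ladjPr lp_join_le.
Qed.

Lemma lp_mulUl a b c : c ** join a b = join (c ** a) (c ** b).
Proof.
by apply: lp_eq_ge => d; rewrite lp_join_le !lp_radjP lp_join_le.
Qed.

Lemma lp_ladjK a : radj (ladj a) = a.
Proof.
apply: lp_eq_le => c.
by rewrite -{1}(lp_mulr1 (radj _)) -lp_radjP lp_ladjP lp_mulr1.
Qed.

Lemma lp_radjK a : ladj (radj a) = a.
Proof.
apply: lp_eq_ge => c.
by rewrite -{1}(lp_mulr1 (ladj _)) lp_ladjP -lp_radjP lp_mulr1.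
Qed.

Lemma lp_le_ladj a b : ladj a <== ladj b <-> b <== a.
Proof.
by rewrite -{1}(lp_mulr1 (ladj a)) lp_ladjP -lp_ladjPr lp_mul1.
Qed.

Lemma lp_ladj1 : ladj one = one :> A.
Proof.
by apply: lp_eq_ge => c; rewrite -{1}(lp_mulr1 (ladj _)) lp_ladjP lp_mul1.
Qed.

Lemma lp_ladjM a b : ladj (a ** b) = ladj b ** ladj a.
Proof.
apply: lp_eq_ge => c.
rewrite -(lp_mulr1 (ladj (a ** b))) -(lp_mulr1 (ladj b ** ladj a)) -lp_mulA !lp_ladjP.
by rewrite lp_mulA.
Qed.

Lemma lp_ladjI a b : ladj (meet a b) = join (ladj a) (ladj b).
Proof.
apply: lp_eq_ge => c; rewrite lp_join_le -(lp_mulr1 (ladj (meet a b))).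
rewrite -(lp_mulr1 (ladj a)) -(lp_mulr1 (ladj b)) !lp_ladjP.
by rewrite lp_mulIr lp_le_meet.
Qed.

Lemma lp_ladjU a b : ladj (join a b) = meet (ladj a) (ladj b).
Proof.
apply: lp_eq_le => c; rewrite lp_le_meet -(lp_mul1 (ladj (join a b))).
rewrite -(lp_mul1 (ladj a)) -(lp_mul1 (ladj b)) -!lp_ladjPr.
by rewrite lp_mulUl lp_join_le.
Qed.

Lemma shift_le a b : shift a <== shift b <-> a <== b.
Proof. by rewrite /shift !lp_le_ladj. Qed.

Lemma shift1 : shift one = one :> A.
Proof. by rewrite /shift !lp_ladj1. Qed.

Lemma shiftM a b : shift (a ** b) = shift a ** shift b.
Proof. by rewrite /shift !lp_ladjM. Qed.

Lemma shiftU a b : shift (join a b) = join (shift a) (shift b).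
Proof. by rewrite /shift lp_ladjU lp_ladjI. Qed.

Lemma shift_radj a : shift (radj a) = radj (shift a).
Proof. by rewrite /shift lp_radjK lp_ladjK. Qed.

Lemma iter_shift_le n a b : a <== b -> iter n (@shift A) a <== iter n (@shift A) b.
Proof. by move=> ab; elim: n => //= n IH; apply/shift_le. Qed.

Lemma iter_shift_fix n a : shift a = a -> iter n (@shift A) a = a.
Proof. by move=> aE; elim: n => //= n ->. Qed.

Lemma iter_shiftM n a b :
  iter n (@shift A) (a ** b) = iter n (@shift A) a ** iter n (@shift A) b.
Proof. by elim: n => //= n ->; rewrite shiftM. Qed.

Lemma iter_shiftU n a b :
  iter n (@shift A) (join a b) = join (iter n (@shift A) a) (iter n (@shift A) b).
Proof. by elim: n => //= n ->; rewrite shiftU. Qed.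

Lemma iter_shift_radj n a : iter n (@shift A) (radj a) = radj (iter n (@shift A) a).
Proof. by elim: n => //= n ->; rewrite shift_radj. Qed.

Lemma le_bmeet (f : nat -> A) n c :
  c <== bmeet f n <-> forall i, (i <= n)%N -> c <== f i.
Proof.
elim: n => [|n IH] /=; first by split => [h [|]//|]; apply.
rewrite lp_le_meet IH; split => [[h1 h2] i|h].
  by rewrite leq_eqVlt ltnS => /orP[/eqP->|/h1].
by split; [move=> i ni; apply: h; exact: leqW | exact: h].
Qed.

Lemma bjoin_le (f : nat -> A) n c :
  bjoin f n <== c <-> forall i, (i <= n)%N -> f i <== c.
Proof.
elim: n => [|n IH] /=; first by split => [h [|]//|]; apply.
rewrite lp_join_le IH; split => [[h1 h2] i|h].
  by rewrite leq_eqVlt ltnS => /orP[/eqP->|/h1].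
by split; [move=> i ni; apply: h; exact: leqW | exact: h].
Qed.

Lemma bmeet_mulr (f : nat -> A) n c :
  bmeet f n ** c = bmeet (fun i => f i ** c) n.
Proof. by elim: n => //= n <-; rewrite lp_mulIr. Qed.

Lemma bjoin_conj (f : nat -> A) n b c :
  b ** bjoin f n ** c = bjoin (fun i => b ** f i ** c) n.
Proof. by elim: n => //= n <-; rewrite lp_mulUl lp_mulUr. Qed.

Lemma eq_bmeet (f g : nat -> A) n : f =1 g -> bmeet f n = bmeet g n.
Proof. by move=> fg; elim: n => //= n ->; rewrite fg. Qed.

Lemma eq_bjoin (f g : nat -> A) n : f =1 g -> bjoin f n = bjoin g n.
Proof. by move=> fg; elim: n => //= n ->; rewrite fg. Qed.

Lemma powS a n : pow a n.+1 = a ** pow a n.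
Proof. by []. Qed.

Lemma powSr a n : pow a n.+1 = pow a n ** a.
Proof.
elim: n => [|n IH]; first by rewrite /pow /= lp_mulr1 lp_mul1.
by rewrite powS [in LHS]IH lp_mulA.
Qed.

Lemma iterop_pow a n : iterop n (@mul A) a one = pow a n.
Proof. by case: n => // n; elim: n => /= [|n ->]; rewrite ?lp_mulr1. Qed.

(** * Invertible elements as the fixed points of [shift] *)

Section Invertible.

Variable h : A.
Hypothesis hH : shift h = h.

(** The law [a^l a <= 1] at [a = h^l] reads [h h^l <= 1], because [h^ll = h]. *)
Lemma inv_mulV : h ** ladj h = one.
Proof.
apply: lp_anti; last exact: (ladj_ge1_ax lpA).
by rewrite -{1}hH; exact: (ladj_le1_ax lpA).
Qed.

Lemma inv_mulKl : ladj h ** h = one.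
Proof.
apply: lp_anti; first exact: (ladj_le1_ax lpA).
by rewrite -{2}hH; exact: (ladj_ge1_ax lpA).
Qed.

Lemma shift_ladj_fix : shift (ladj h) = ladj h.
Proof. by rewrite /shift -/(shift h) hH. Qed.

Lemma shift_pow_fix n : shift (pow h n) = pow h n.
Proof. by elim: n => [|n IH]; rewrite ?powS ?shiftM ?hH ?IH //; exact: shift1. Qed.

Lemma ladj_pow n : ladj (pow h n) = pow (ladj h) n.
Proof. by elim: n => [|n IH]; [exact: lp_ladj1 | rewrite powSr lp_ladjM IH]. Qed.

End Invertible.

Section Periodic.

Variable k : nat.
Hypothesis periodic : forall a, iter k.+1 (@shift A) a = a.

(** The shift permutes the [k.+1] meetands cyclically, so [shift s <= s]. Iterating this gives
    [shift^(k+1) s <= shift s], whose left side is [s]. *)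
Lemma bmeet_shift_fix a :
  shift (bmeet (fun j => iter j (@shift A) a) k) =
  bmeet (fun j => iter j (@shift A) a) k.
Proof.
set s := bmeet _ _.
have dec : shift s <== s.
  apply/le_bmeet => -[_|j jk] /=.
    rewrite -[X in _ <== X](periodic a) /=; apply/shift_le.
    by have /le_bmeet := lp_refl s; apply.
  by apply/shift_le; have /le_bmeet := lp_refl s; apply; exact: ltnW.
apply: lp_anti => //; rewrite -[X in X <== _](periodic s) /=; apply/shift_le.
elim: (k) => [|n IH] /=; first exact: lp_refl.
by apply: lp_trans dec; apply/shift_le.
Qed.

Lemma bjoin_shift_fix a :
  shift (bjoin (fun j => iter j (@shift A) a) k) =
  bjoin (fun j => iter j (@shift A) a) k.
Proof.
set s := bjoin _ _.
have inc : s <== shift s.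
  apply/bjoin_le => -[_|j jk] /=.
    rewrite -[X in X <== _](periodic a) /=; apply/shift_le.
    by have /bjoin_le := lp_refl s; apply.
  by apply/shift_le; have /bjoin_le := lp_refl s; apply; exact: ltnW.
apply: lp_anti => //; rewrite -[X in _ <== X](periodic s) /=; apply/shift_le.
elim: (k) => [|n IH] /=; first exact: lp_refl.
by apply: (lp_trans inc); apply/shift_le.
Qed.

End Periodic.

End LPregroup.

Lemma iter_double_ladj (A : algebra) n (a : A) :
  iter (2 * n) (@ladj A) a = iter n (@shift A) a.
Proof.
by elim: n => // n IH; rewrite mulnS iterD IH.
Qed.

Lemma eval_tshift (A : algebra) (v : var -> A) n t :
  eval v (tshift n t) = iter n (@shift A) (eval v t).
Proof.
by rewrite /tshift -iter_double_ladj; elim: (2 * n)%N => // m /= ->.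
Qed.

Lemma eval_sigma (A : algebra) (v : var -> A) k t :
  eval v (sigma k.+1 t) = bmeet (fun j => iter j (@shift A) (eval v t)) k.
Proof.
rewrite /sigma [k.+1.-1]/=; elim: k => // k IH.
rewrite -[k.+1]addn1 iotaD foldl_cat addn1 add1n.
by rewrite -[bmeet _ k.+1]/(meet (bmeet _ k) (iter k.+1 _ _)) -IH -eval_tshift.
Qed.

Lemma eval_texp (A : algebra) (lpA : is_lpregroup A) (v : var -> A) t n :
  eval v (texp t n) = pow (eval v t) n.
Proof.
rewrite -iterop_pow // /texp; case: n => // n; elim: n => // n IH.
by rewrite /iterop /= in IH *; rewrite IH.
Qed.

(** * Homomorphisms, equational description of DLP, and F(Z) *)

Record is_hom (A B : algebra) (f : A -> B) : Prop := {
  hom_meet : {morph f : a b / meet a b};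
  hom_join : {morph f : a b / join a b};
  hom_mul : {morph f : a b / a ** b};
  hom_one : f one = one;
  hom_ladj : {morph f : a / ladj a};
  hom_radj : {morph f : a / radj a} }.

Lemma eval_hom (A B : algebra) (f : A -> B) (v : var -> A) t :
  is_hom f -> f (eval v t) = eval (f \o v) t.
Proof.
case=> fI fU fM f1 fl fr.
by elim: t => //= [s <- t <-|s <- t <-|s <- t <-|t <-|t <-].
Qed.

Lemma satisfies_hom_inj (A B : algebra) (f : A -> B) e :
  is_hom f -> injective f -> satisfies B e -> satisfies A e.
Proof. by move=> fh finj Be v; apply: finj; rewrite !(eval_hom _ _ fh). Qed.

Lemma satisfies_hom_surj (A B : algebra) (f : A -> B) (g : B -> A) e :
  is_hom f -> cancel g f -> satisfies A e -> satisfies B e.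
Proof.
move=> fh gK Ae v; have -> : v = f \o (g \o v) by apply/funext => x /=; rewrite gK.
by rewrite -!(eval_hom _ _ fh) Ae.
Qed.

Lemma is_hom_sval (A : algebra) (P : set A) (HP : subuniverse P) :
  @is_hom (subalgebra HP) A sval.
Proof. by []. Qed.

Lemma sval_subalgebra_inj (A : algebra) (P : set A) (HP : subuniverse P) :
  injective (sval : subalgebra HP -> A).
Proof. by move=> [a Pa] [b Pb] /= ab; exact: eq_exist. Qed.

(** Taking all valid equations instead of a list of axioms makes the passage to subalgebras and
    quotients immediate. *)
Definition DLP_theory : set equation :=
  [set e | forall A, DLP A -> satisfies A e].

Lemma DLP_modelsE : DLP = models DLP_theory.
Proof.
apply/seteqP; split => [A DA e|A mA]; first exact.
have vE (s t : term) : (forall B, DLP B -> satisfies B (s, t)) ->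
    forall a b c d : A, let v i := nth a [:: a; b; c; d] i in
    eval (fun x => match x with vx i => v i | _ => a end) s =
    eval (fun x => match x with vx i => v i | _ => a end) t.
  by move=> st a b c d; apply: (mA (s, t)).
pose x := tvar (vx 0); pose y := tvar (vx 1); pose z := tvar (vx 2).
pose w := tvar (vx 3).
split; first split.
- move=> a b c; apply: (vE (tmeet x (tmeet y z)) (tmeet (tmeet x y) z) _ a b c a).
  by move=> B [lpB _] v; exact: (meetA_ax lpB).
- move=> a b; apply: (vE (tmeet x y) (tmeet y x) _ a b a a).
  by move=> B [lpB _] v; exact: (meetC_ax lpB).
- move=> a b c; apply: (vE (tjoin x (tjoin y z)) (tjoin (tjoin x y) z) _ a b c a).
  by move=> B [lpB _] v; exact: (joinA_ax lpB).
- move=> a b; apply: (vE (tjoin x y) (tjoin y x) _ a b a a).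
  by move=> B [lpB _] v; exact: (joinC_ax lpB).
- move=> a b; apply: (vE (tmeet x (tjoin x y)) x _ a b a a).
  by move=> B [lpB _] v; exact: (meetKU_ax lpB).
- move=> a b; apply: (vE (tjoin x (tmeet x y)) x _ a b a a).
  by move=> B [lpB _] v; exact: (joinKI_ax lpB).
- move=> a b c; apply: (vE (tmul x (tmul y z)) (tmul (tmul x y) z) _ a b c a).
  by move=> B [lpB _] v; exact: (mulA_ax lpB).
- move=> a; apply: (vE (tmul tone x) x _ a a a a).
  by move=> B [lpB _] v; exact: (mul1_ax lpB).
- move=> a; apply: (vE (tmul x tone) x _ a a a a).
  by move=> B [lpB _] v; exact: (mulr1_ax lpB).
(* Replacing [a] by [meet a b] and [c] by [meet c d] turns the implication into an equation. *)
- move=> a b c d ab cd; rewrite ab cd.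
  apply: (vE (tmul (tmeet x y) (tmeet z w))
    (tmeet (tmul (tmeet x y) (tmeet z w)) (tmul y w)) _ a b c d).
  move=> B [lpB _] v; apply: (lp_mul2 lpB); exact: lp_meetr.
- move=> a; apply: (vE (tmul (tladj x) x) (tmeet (tmul (tladj x) x) tone) _ a a a a).
  by move=> B [lpB _] v; exact: (ladj_le1_ax lpB).
- move=> a; apply: (vE tone (tmeet tone (tmul x (tladj x))) _ a a a a).
  by move=> B [lpB _] v; exact: (ladj_ge1_ax lpB).
- move=> a; apply: (vE (tmul x (tradj x)) (tmeet (tmul x (tradj x)) tone) _ a a a a).
  by move=> B [lpB _] v; exact: (radj_le1_ax lpB).
- move=> a; apply: (vE tone (tmeet tone (tmul (tradj x) x)) _ a a a a).
  by move=> B [lpB _] v; exact: (radj_ge1_ax lpB).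
- move=> a b c; apply: (vE (tmeet (tjoin x y) z)
    (tjoin (tmeet x z) (tmeet y z)) _ a b c a).
  by move=> B [_ dB] v; exact: dB.
Qed.

Lemma DLP_models_variety E : is_variety (DLP `&` models E).
Proof.
exists (DLP_theory `|` E); rewrite DLP_modelsE.
apply/seteqP; split => [A [A1 A2] e [/A1|/A2]//|A AE].
by split => e ?; apply: AE; [left|right].
Qed.

Section FZ.
Local Open Scope ring_scope.
Import Order.TTheory GRing.Theory Num.Theory.

Lemma FZ_ext (f g : FZ) : (forall x, sval f x = sval g x) -> f = g.
Proof. by case: f g => [f Ff] [g Fg] /= fg; apply/eq_exist/funext. Qed.

Lemma FZ_leP (f g : FZ) : (f <== g) <-> forall x, sval f x <= sval g x.
Proof.
split=> [fg x|fg]; last by apply: FZ_ext => x; rewrite /= /meet_fun min_l.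
by rewrite {1}fg /= /meet_fun ge_min lexx orbT.
Qed.

Lemma FZ_mono (f : FZ) x y : x <= y -> sval f x <= sval f y.
Proof. exact: (svalP f).1. Qed.

Lemma FZ_DLP : DLP FZ.
Proof.
split; first split.
- by move=> f g h; apply: FZ_ext => x; rewrite /= /meet_fun /= minA.
- by move=> f g; apply: FZ_ext => x; rewrite /= /meet_fun /= minC.
- by move=> f g h; apply: FZ_ext => x; rewrite /= /join_fun /= maxA.
- by move=> f g; apply: FZ_ext => x; rewrite /= /join_fun /= maxC.
- by move=> f g; apply: FZ_ext => x; rewrite /= /join_fun /meet_fun /=; lia.
- by move=> f g; apply: FZ_ext => x; rewrite /= /join_fun /meet_fun /=; lia.
- by move=> f g h; apply: FZ_ext.
- by move=> f; apply: FZ_ext.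
- by move=> f; apply: FZ_ext.
- move=> f g h i /FZ_leP fg /FZ_leP hi; apply/FZ_leP => x /=.
  exact: le_trans (fg _) (FZ_mono _ (hi _)).
- by move=> f; apply/FZ_leP => x; rewrite /= ladj_galois //; exact: svalP.
- by move=> f; apply/FZ_leP => x /=; rewrite -ladj_galois //; exact: svalP.
- by move=> f; apply/FZ_leP => x /=; rewrite -radj_galois //; exact: svalP.
- by move=> f; apply/FZ_leP => x /=; rewrite radj_galois //; exact: svalP.
- move=> f g h; apply: FZ_ext => x; rewrite /= /join_fun /meet_fun /= /join_fun.
  by rewrite /meet_fun; lia.
Qed.

(** By adjunction, [f^ll x <= p] means [x <= f^l p], that is, not [f^l p <= x - 1], that is,
    [f (x - 1) < p]. *)
Lemma FZ_shiftE (f : FZ) x : sval (shift f) x = sval f (x - 1) + 1.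
Proof.
suff E p : (sval (shift f) x <= p) = (sval f (x - 1) + 1 <= p).
  by apply/eqP; rewrite eq_le E lexx -E lexx.
rewrite /shift FZ_ladj_galois leNgt lezD1.
have -> : (sval (ladj f) p < x) = (sval (ladj f) p <= x - 1) by lia.
by rewrite FZ_ladj_galois -ltNge.
Qed.

Lemma FZ_iter_shiftE n (f : FZ) x :
  sval (iter n (@shift FZ) f) x = sval f (x - n%:Z) + n%:Z.
Proof.
elim: n x => [|n IH] x; first by rewrite subr0 addr0.
have -> : x - n.+1%:Z = x - 1 - n%:Z by lia.
by rewrite iterS FZ_shiftE IH; lia.
Qed.

(** Cancelling [n] right adjoints turns the condition into [f^[n] = f], and [f^[n]] is the conjugate
    of [f] by translation by [n]. *)
Lemma is_FnP n (f : FZ) : is_Fn n f <-> forall x, sval f (x + n%:Z) = sval f x + n%:Z.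
Proof.
have E : is_Fn n f <-> iter n (@shift FZ) f = f.
  rewrite -iter_double_ladj mul2n -addnn iterD.
  have lrK m (g : FZ) : iter m (@ladj FZ) (iter m (@radj FZ) g) = g.
    by elim: m g => // m IH g; rewrite iterSr iterS FZ_radjK IH.
  have rlK m (g : FZ) : iter m (@radj FZ) (iter m (@ladj FZ) g) = g.
    by elim: m g => // m IH g; rewrite iterSr iterS FZ_ladjK IH.
  rewrite /is_Fn /mkset.
  by split=> [->|fE]; rewrite ?lrK // -[in RHS]fE rlK.
split=> [/E fE x|fE].
  by rewrite -[in LHS]fE FZ_iter_shiftE addrK.
by apply/E; apply: FZ_ext => x; rewrite FZ_iter_shiftE -fE subrK.
Qed.

Lemma Fn_DLP n : DLP (Fn n).
Proof.
rewrite DLP_modelsE => e eD; apply: satisfies_hom_inj (is_hom_sval _) _ _.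
  exact: sval_subalgebra_inj.
exact: eD FZ_DLP.
Qed.

Lemma eval_Fn n (v : var -> Fn n) t :
  sval (eval v t) = eval (fun x => sval (v x) : FZ) t.
Proof. exact: (eval_hom _ _ (is_hom_sval (is_Fn_subuniverse n))). Qed.

End FZ.

(** * Totally ordered abelian groups with a least positive element *)

Section Euclid.
Local Open Scope ring_scope.
Import Order.TTheory GRing.Theory Num.Theory.

Definition upd (I : eqType) (V : Type) (f : I -> V) i x : I -> V :=
  fun l => if l == i then x else f l.

Lemma upd_same (I : eqType) (V : Type) (f : I -> V) i x : upd f i x i = x.
Proof. by rewrite /upd eqxx. Qed.

Lemma upd_other (I : eqType) (V : Type) (f : I -> V) i x j :
  j != i -> upd f i x j = f j.
Proof. by rewrite /upd => /negbTE->. Qed.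

(** The change of generators in one Euclidean step: [g i v i + g j v j = (g i - g j) v i + g j (v j
    + v i)]. *)
Lemma sum_updB (I : finType) (V : zmodType) (g : I -> V) (v : I -> int) i j :
  i != j ->
  \sum_l upd g i (g i - g j) l *~ upd v j (v j + v i) l = \sum_l g l *~ v l.
Proof.
move=> ij; rewrite (bigD1 i) //= (bigD1 j) 1?eq_sym //=.
rewrite [RHS](bigD1 i) //= [in RHS](bigD1 j) 1?eq_sym //= !upd_same.
rewrite !upd_other // 1?eq_sym // addrA [RHS]addrA; congr (_ + _).
  by rewrite mulrzBl mulrzDr [_ *~ v j + _]addrC addrA subrK.
by apply: eq_bigr => l /andP[li lj]; rewrite !upd_other.
Qed.

(* [nn] is the cone of nonnegative elements of a totally ordered abelian group
   with least positive element [T], and [K] is a subgroup of [G * int]: it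
   prescribes the residue that an approximation [G -> int] must have. *)
Record is_discrete (G : zmodType) (nn : G -> Prop) (K : G -> int -> Prop)
    (k : int) (T : G) : Prop := {
  discD : forall u v, nn u -> nn v -> nn (u + v);
  disc_anti : forall u, nn u -> nn (- u) -> u = 0;
  disc_total : forall u, nn u \/ nn (- u);
  disc_KD : forall u v m n, K u m -> K v n -> K (u + v) (m + n);
  disc_KN : forall u m, K u m -> K (- u) (- m);
  disc_Ktot : forall u, exists m, K u m;
  disc_k_gt0 : 0 < k;
  disc_Kk : K 0 k;
  disc_KT : K T 1;
  disc_Tnn : nn T;
  disc_Tneq0 : T <> 0;
  disc_Tmin : forall u, nn u -> u <> 0 -> nn (u - T) }.

Variables (G : zmodType) (nn : G -> Prop).
Variables (K : G -> int -> Prop) (k : int) (T : G).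
Hypothesis disc : is_discrete nn K k T.

Let nnD := discD disc.
Let nn_anti := disc_anti disc.
Let nn_total := disc_total disc.
Let KD := disc_KD disc.
Let KN := disc_KN disc.
Let Ktot := disc_Ktot disc.
Let k_gt0 := disc_k_gt0 disc.
Let Kk := disc_Kk disc.
Let KT := disc_KT disc.
Let T_nn := disc_Tnn disc.
Let T_neq0 := disc_Tneq0 disc.
Let T_min := disc_Tmin disc.

Lemma nn0 : nn 0.
Proof. by case: (nn_total 0); rewrite ?oppr0. Qed.

Lemma nn_mulz u m : nn u -> 0 <= m -> nn (u *~ m).
Proof.
move=> un; case: m => // m _; rewrite -pmulrn.
by elim: m => [|m IH]; [exact: nn0 | rewrite mulrS; exact: nnD].
Qed.

Lemma nn_add0 u v : nn u -> nn v -> u + v = 0 -> u = 0.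
Proof.
by move=> un vn uv; apply: nn_anti => //; rewrite (addr0_eq uv).
Qed.

Lemma nn_mulz0 u m : nn u -> 0 < m -> u *~ m = 0 -> u = 0.
Proof.
move=> un; case: m => // -[//|m] _; rewrite -pmulrn mulrS => /nn_add0; apply=> //.
by rewrite pmulrn; apply: nn_mulz.
Qed.

Lemma nn_sum0 (I : finType) (g : I -> G) :
  (forall i, nn (g i)) -> \sum_i g i = 0 -> forall i, g i = 0.
Proof.
move=> gn s0 i; move: s0; rewrite (bigD1 i) //= => /nn_add0; apply => //.
by apply: (big_ind nn) => //; exact: nn0.
Qed.

Lemma K0 : K 0 0.
Proof.
by have [m Km] := Ktot 0; have := KD Km (KN Km); rewrite oppr0 addr0 subrr.
Qed.

Lemma K_pos u : exists2 m, 0 < m & K u m.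
Proof.
(* Since [k] is a residue of 0, adding a multiple of it to a residue of [u] gives another one. *)
have [m Km] := Ktot u; exists (m + k * `|m|%:Z + k); first by nia.
have Kkn (n : nat) : K 0 (k * n%:Z).
  elim: n => [|n IH]; first by rewrite mulr0; exact: K0.
  by have := KD Kk IH; rewrite addr0 intS mulrDr mulr1.
by have := KD (KD Km (Kkn `|m|%N)) Kk; rewrite !addr0.
Qed.

(** The last clause says that [g i |-> c i] extends to a homomorphism into [int] from the subgroup
    generated by the [g i]. *)
Definition approximable (I : finType) (g : I -> G) : Prop :=
  exists c : I -> int, [/\ forall i, K (g i) (c i),
    forall i, g i = 0 -> c i = 0, forall i, g i <> 0 -> 0 < c i,
    forall i, g i = T -> c i = 1
  & forall v : I -> int, \sum_i g i *~ v i = 0 -> \sum_i c i *~ v i = 0].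

(** The value at [i] becomes [c i + c j]. If [g i = T], leastness of [T] forces one of [g j] and
    [g i - g j] to be [T] and the other to be 0. *)
Lemma approximable_sub (I : finType) (g : I -> G) i j :
  i != j -> nn (g i - g j) -> nn (g j) ->
  approximable (upd g i (g i - g j)) -> approximable g.
Proof.
move=> ij gij gj [c [cK c0 cp cT cr]]; have ji : j != i by rewrite eq_sym.
have cJ := cK j; have c0J := c0 j; have cpJ := cp j; have cTJ := cT j.
have cI := cK i; have c0I := c0 i; have cpI := cp i; have cTI := cT i.
rewrite upd_same in cI c0I cpI cTI; rewrite upd_other // in cJ c0J cpJ cTJ.
have cge : 0 <= c i /\ 0 <= c j.
  by split; [have [/c0I->|/cpI/ltW] := EM (g i - g j = 0)
            |have [/c0J->|/cpJ/ltW] := EM (g j = 0)].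
exists (upd c i (c i + c j)); split => [l|l|l|l|v gv].
- have [->|li] := eqVneq l i; last by have := cK l; rewrite !upd_other.
  by rewrite upd_same -(subrK (g j) (g i)); exact: KD.
- have [->|li] := eqVneq l i; last by have := c0 l; rewrite !upd_other.
  rewrite upd_same => gi0.
  have gij0 : g i - g j = 0 by apply: (nn_add0 gij gj); rewrite subrK.
  by rewrite c0I // c0J // -[g j]opprK -[- g j]add0r -gi0 gij0 oppr0.
- have [->|li] := eqVneq l i; last by have := cp l; rewrite !upd_other.
  rewrite upd_same => gi0.
  have [/[dup] gj0 /c0J cj|/cpJ] := EM (g j = 0); last by lia.
  by have := cpI; rewrite gj0 subr0 => /(_ gi0); lia.
- have [->|li] := eqVneq l i; last by have := cT l; rewrite !upd_other.
  rewrite upd_same => giT.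
  have [/[dup] gj0 /c0J ->|gj0] := EM (g j = 0).
    by rewrite cTI ?addr0 // gj0 subr0.
  have gjT : nn (g j - T) by exact: T_min.
  have gij0 : g i - g j = 0.
    by apply: nn_anti => //; rewrite giT opprB.
  by rewrite c0I // add0r cTJ // -giT; apply/esym/subr0_eq.
- have /cr : \sum_l upd g i (g i - g j) l *~ upd v j (v j + v i) l = 0.
    by rewrite sum_updB.
  move=> cv; rewrite -(sum_updB (upd c i (c i + c j)) v ij) -[RHS]cv.
  apply: eq_bigr => l _; congr (_ *~ _).
  have [->|li] := eqVneq l i; last by rewrite !upd_other.
  by rewrite !upd_same upd_other // addrK.
Qed.

Definition nsupp (I : finType) (g : I -> G) : nat := #|[pred i | g i != 0]|.

Lemma nsupp_upd0 (I : finType) (g : I -> G) i :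
  g i <> 0 -> (nsupp (upd g i 0%R) < nsupp g)%N.
Proof.
move=> gi; apply/proper_card/properP; split.
  apply/fintype.subsetP => l; rewrite !inE; have [->|li] := eqVneq l i.
    by rewrite upd_same eqxx.
  by rewrite upd_other.
by exists i; rewrite !inE ?upd_same ?eqxx //; exact/eqP.
Qed.

Lemma nsupp_upd (I : finType) (g : I -> G) i x :
  g i <> 0 -> (nsupp (upd g i x) <= nsupp g)%N.
Proof.
move=> gi; apply/subset_leq_card/fintype.subsetP => l; rewrite !inE.
by have [->|li] := eqVneq l i; [move=> _; exact/eqP | rewrite upd_other].
Qed.

(* Subtractive Euclidean algorithm on an integer relation [v] between the
   [g i]: with [v i = M] of maximal modulus, each step either removes an index
   from the negative part of [v], or makes the coefficient of [i] smaller. *)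
Lemma approximable_dependent (I : finType) (n : nat) :
  (forall g : I -> G, (forall i, nn (g i)) -> (nsupp g < n)%N ->
    approximable g) ->
  forall (M : nat) (g : I -> G) (v : I -> int),
    (forall i, nn (g i)) -> (nsupp g <= n)%N ->
    \sum_i g i *~ v i = 0 -> (forall i, v i != 0 -> g i <> 0) ->
    (exists i, v i != 0) -> (forall i, (`|v i| <= M)%N) -> approximable g.
Proof.
move=> IHn; elim=> [|M IHM] g v.
  by move=> _ _ _ _ [i vi] /(_ i); rewrite leqn0 absz_eq0 (negbTE vi).
have [q] := ubnP #|[pred i | `|v i|%N == M.+1]|.
elim: q g v => // q IHq g v.
have main : forall (r : nat) (g : I -> G) (v : I -> int) i,
    (#|[pred i | `|v i|%N == M.+1]| < q.+1)%N ->
    (#|[pred j | (v j < 0)%R]| < r)%N -> v i = M.+1 ->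
    (forall i, nn (g i)) -> (nsupp g <= n)%N ->
    \sum_i g i *~ v i = 0 -> (forall i, v i != 0 -> g i <> 0) ->
    (forall i, (`|v i| <= M.+1)%N) -> approximable g.
  elim=> // r IHr {}g {}v i vq vr vi gn gs gv gsupp vM.
  have gi0 : g i <> 0 by apply: gsupp; rewrite vi.
  (* Without a negative coefficient, the relation is a vanishing sum of nonnegative terms, against
     [g i <> 0] and [v i > 0]. *)
  have [j vj|vpos] := pickP [pred j | (v j < 0)%R]; last first.
    exfalso; apply: gi0; apply: (@nn_mulz0 _ (v i)); rewrite ?vi // -vi.
    apply: nn_sum0 gv _ => l; apply: nn_mulz => //.
    by have := vpos l; rewrite /=; lia.
  rewrite /= in vj.
  have ij : i != j by apply: contraTneq vj => <-; rewrite vi.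
  have ji : j != i by rewrite eq_sym.
  have gj0 : g j <> 0 by apply: gsupp; lia.
  (* The smaller of [g i] and [g j] is subtracted from the larger. Either [v j] becomes
     [v j + M.+1 >= 0], or [v i] becomes [v i + v j], of modulus at most [M]. A zero difference
     shrinks the support. *)
  have [gij|gji] := nn_total (g i - g j).
    apply: (approximable_sub ij gij (gn j)).
    have [gij0|gij0] := EM (g i - g j = 0).
      rewrite gij0; apply: IHn; last exact: leq_trans (nsupp_upd0 gi0) gs.
      move=> l; have [->|li] := eqVneq l i; last by rewrite upd_other.
      by rewrite upd_same; exact: nn0.
    have vjM := vM j.
    apply: (IHr _ (upd v j (v j + v i)) i).
    - apply: leq_ltn_trans vq; apply/subset_leq_card/fintype.subsetP => l.
      rewrite !inE; have [->|lj] := eqVneq l j; last by rewrite upd_other.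
      by rewrite upd_same; lia.
    - apply: leq_trans (_ : (#|[pred j | (v j < 0)%R]| <= r)%N); last by [].
      apply/proper_card/properP; split; last first.
        by exists j; rewrite ?inE // upd_same; lia.
      apply/fintype.subsetP => l; rewrite !inE.
      have [->|lj] := eqVneq l j; last by rewrite upd_other.
      by rewrite upd_same; lia.
    - by rewrite upd_other.
    - by move=> l; have [->|li] := eqVneq l i; rewrite ?upd_same ?upd_other.
    - exact: leq_trans (nsupp_upd _ gi0) gs.
    - by rewrite sum_updB.
    - move=> l; have [->|li] := eqVneq l i; first by rewrite upd_same.
      rewrite (upd_other g) //; have [->//|lj] := eqVneq l j.
      by rewrite upd_other //; exact: gsupp.
    - move=> l; have [->|lj] := eqVneq l j; last by rewrite upd_other.
      by rewrite upd_same; lia.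
  rewrite opprB in gji; apply: (approximable_sub ji gji (gn i)).
  have [gji0|gji0] := EM (g j - g i = 0).
    rewrite gji0; apply: IHn; last exact: leq_trans (nsupp_upd0 gj0) gs.
    move=> l; have [->|li] := eqVneq l j; last by rewrite upd_other.
    by rewrite upd_same; exact: nn0.
  have vjM := vM j.
  apply: (IHq _ (upd v i (v i + v j))).
  - apply: leq_trans (_ : (#|[pred i | `|v i|%N == M.+1]| <= q)%N); last by [].
    apply/proper_card/properP; split; last first.
      by exists i; rewrite ?inE ?upd_same; lia.
    apply/fintype.subsetP => l; rewrite !inE.
    have [->|lj] := eqVneq l i; last by rewrite upd_other.
    by rewrite upd_same; lia.
  - by move=> l; have [->|li] := eqVneq l j; rewrite ?upd_same ?upd_other.
  - exact: leq_trans (nsupp_upd _ gj0) gs.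
  - by rewrite sum_updB.
  - move=> l; have [->|li] := eqVneq l j; first by rewrite upd_same.
    rewrite (upd_other g) //; have [->//|lj] := eqVneq l i.
    by rewrite upd_other //; exact: gsupp.
  - by exists j; rewrite upd_other //; lia.
  - move=> l; have [->|lj] := eqVneq l i; last by rewrite upd_other.
    by rewrite upd_same; lia.
move=> vq gn gs gv gsupp [i0 vi0] vM.
have [i /eqP vi|none] := pickP [pred i | `|v i|%N == M.+1]; last first.
  apply: (IHM g v) => //; first by exists i0.
  by move=> i; have := none i; have := vM i; rewrite /=; lia.
have [vi'|vi'] : v i = M.+1 \/ - v i = M.+1 by lia.
  exact: (main _ g v i vq (ltnSn _)).
apply: (main _ g (fun l => - v l) i _ (ltnSn _)) => //.
- rewrite (eq_card (B := [pred i | `|v i|%N == M.+1])) // => l.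
  by rewrite !inE abszN.
- by under eq_bigr do rewrite mulrNz; rewrite sumrN gv oppr0.
- by move=> l; rewrite oppr_eq0; exact: gsupp.
- by move=> l; rewrite abszN.
Qed.

(** Induction on the support. A relation among nonzero members is handled by the Euclidean steps;
    without one they are independent, and each value can be chosen separately. *)
Lemma nn_approximable (I : finType) (g : I -> G) :
  (forall i, nn (g i)) -> approximable g.
Proof.
have [n] := ubnP (nsupp g); elim: n g => // n IHn g gs gn.
have [[v [gv [i [gi vi]]]]|indep] := EM (exists v : I -> int,
    \sum_i g i *~ v i = 0 /\ exists i, g i <> 0 /\ v i != 0).
  pose w l := if g l == 0 then 0 else v l.
  apply: (@approximable_dependent I n _ (\max_l `|w l|)%N g w) => //.
  - by move=> g' gn' gs'; apply: IHn.
  - rewrite -[RHS]gv; apply: eq_bigr => l _; rewrite /w.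
    by case: eqP => // ->; rewrite !mul0rz.
  - by move=> l; rewrite /w; have [|/eqP] := eqVneq (g l) 0.
  - by exists i; rewrite /w; have [|] := eqVneq (g i) 0.
  - by move=> l; apply: (leq_bigmax (F := fun l => `|w l|%N)).
have /choice [c cP] : forall i, exists m, [/\ K (g i) m,
    g i = 0 -> m = 0, g i <> 0 -> 0 < m & g i = T -> m = 1].
  move=> i; have [gT|gT] := EM (g i = T).
    by exists 1; split => //; rewrite gT // => /T_neq0.
  have [->|g0] := EM (g i = 0).
    by exists 0; split => //; [exact: K0 | move=> /esym].
  by have [m m0 Km] := K_pos (g i); exists m.
exists c; split => [i|i|i|i|v gv]; try by case: (cP i).
apply: big1 => i _; have [/[dup] gi|gi] := EM (g i = 0).
  by have [_ -> //] := cP i; rewrite mul0rz.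
have [->|vi] := eqVneq (v i) 0; first by rewrite mulr0z.
by case: indep; exists v; split => //; exists i.
Qed.

End Euclid.

(** * Approximating an ordered group by the integers *)

Section PeriodicMaps.
Local Open Scope ring_scope.
Import Order.TTheory GRing.Theory Num.Theory.

Lemma homo_int_step (g : int -> int) :
  (forall m, g m <= g (m + 1)) -> {homo g : x y / x <= y}.
Proof.
move=> gs x y xy; have -> : y = x + `|y - x|%N%:Z by lia.
elim: `|y - x|%N => [|n IH]; first by rewrite addr0.
by apply: le_trans IH _; rewrite intS [1 + _]addrC addrA.
Qed.

Lemma is_FZ_periodic (k : nat) (g : int -> int) : (0 < k)%N ->
  (forall m, g m <= g (m + 1)) -> (forall m, g (m + k%:Z) = g m + k%:Z) ->
  is_FZ g.
Proof.
move=> k0 /homo_int_step gh gk; apply/is_FZP.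
have gnk m (n : nat) : g (m + (k * n)%N%:Z) = g m + (k * n)%N%:Z.
  elim: n => [|n IH]; first by rewrite muln0 !addr0.
  by rewrite mulnS addnC PoszD !addrA gk IH.
split=> // q; pose d := q - g 0.
- exists (0 + (k * `|d|)%N%:Z); rewrite gnk.
  by move: (k * _)%N (leq_pmull `|d|%N k0) => N; lia.
- exists (0 - (k * `|d|)%N%:Z).
  have -> : g (0 - (k * `|d|)%N%:Z) = g 0 - (k * `|d|)%N%:Z.
    by rewrite -[in RHS](subrK (k * `|d|)%N%:Z 0) gnk addrK.
  by move: (k * _)%N (leq_pmull `|d|%N k0) => N; lia.
Qed.

End PeriodicMaps.

Section Approximation.
Local Open Scope ring_scope.
Import Order.TTheory GRing.Theory Num.Theory.

Variables (G : zmodType) (nn : G -> Prop) (K : G -> int -> Prop).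
Variables (k : nat) (T : G).
Hypothesis disc : is_discrete nn K k T.

Definition good (L : seq G) (f : G -> int) : Prop :=
  [/\ forall u, u \in L -> K u (f u),
      forall u, u \in L -> nn u -> u <> 0 -> 0 < f u,
      T \in L -> f T = 1
    & forall u v, u \in L -> v \in L -> f (u + v) = f u + f v].

Lemma sum_mulz1 (I : finType) (V : zmodType) (g : I -> V) i m :
  \sum_l g l *~ (if l == i then m else 0) = g i *~ m.
Proof.
rewrite (bigD1 i) //= eqxx big1 ?addr0 // => l /negbTE->.
by rewrite mulr0z.
Qed.

Lemma good_exists L : exists f, good L f.
Proof.
(* Sums of pairs are included so that additivity on [L] is a linear relation within the family; [sg]
   is the sign that makes each member nonnegative. *)
pose L2 := L ++ [seq u + v | u <- L, v <- L].
pose sg u : int := if `[< nn u >] then 1 else -1.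
have sgK u : u *~ sg u *~ sg u = u.
  by rewrite /sg; case: asboolP => _; rewrite ?mulr1z // !mulrN1z opprK.
have nn_sg u : nn (u *~ sg u).
  rewrite /sg; case: asboolP => [|un]; rewrite ?mulr1z // mulrN1z.
  by case: (disc_total disc u).
pose g (i : 'I_(size L2)) := let u := nth 0 L2 i in u *~ sg u.
have [c [cK c0 cp cT cr]] := nn_approximable disc (g := g) (fun i => nn_sg _).
pose f u := if insub (index u L2) is Some i then c i *~ sg u else 0.
have fE u : u \in L2 -> exists i, g i = u *~ sg u /\ f u = c i *~ sg u.
  move=> uL; rewrite /f; have iL : (index u L2 < size L2)%N by rewrite index_mem.
  by rewrite insubT; exists (Ordinal iL); rewrite /g /= nth_index.
have LL2 u : u \in L -> u \in L2 by rewrite mem_cat => ->.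
exists f; split => [u /LL2/fE[i [gi ->]]|u /LL2/fE[i [gi ->]] un u0
  |/LL2/fE[i [gi ->]]|u v uL vL].
- have := cK i; rewrite gi /sg; case: asboolP => _; rewrite ?mulr1z //.
  by rewrite !mulrN1z => /(disc_KN disc); rewrite opprK.
- move: gi; rewrite /sg asboolT // !mulr1z => gi.
  by apply: cp; rewrite gi.
- move: gi; rewrite /sg asboolT ?mulr1z; last exact: disc_Tnn disc.
  exact: cT.
- have /fE[i [gi ->]] : u + v \in L2 by rewrite mem_cat allpairs_f ?orbT.
  have /fE[j [gj ->]] := LL2 _ uL; have /fE[l [gl ->]] := LL2 _ vL.
  (* The coefficients of [(u + v) - (u + v) = 0] in terms of the family. Indicators are summed
     because [i], [j] and [l] may coincide. *)
  pose w m : int := (if m == i then sg (u + v) else 0) -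
    ((if m == j then sg u else 0) + (if m == l then sg v else 0)).
  have sumw (V : zmodType) (h : _ -> V) :
      \sum_m h m *~ w m = h i *~ sg (u + v) - (h j *~ sg u + h l *~ sg v).
    by under eq_bigr do rewrite mulrzBr mulrzDr;
      rewrite sumrB big_split /= !sum_mulz1.
  have /cr : \sum_m g m *~ w m = 0 by rewrite sumw gi gj gl !sgK subrr.
  by rewrite sumw => /subr0_eq.
Qed.

Lemma good_sub L1 L2 f : {subset L1 <= L2} -> good L2 f -> good L1 f.
Proof.
by move=> s [h1 h2 h3 h4]; split=> [u /s/h1|u /s/h2|/s/h3|u v /s + /s]; last exact: h4.
Qed.

(* [P f] holds for every [f] that is additive, positive on positive elements and
   compatible with [K] on a large enough finite set. *)
Definition ev (P : (G -> int) -> Prop) : Prop :=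
  exists L, forall f, good L f -> P f.

Lemma ev_and P Q : ev P -> ev Q -> ev (fun f => P f /\ Q f).
Proof.
move=> [L1 h1] [L2 h2]; exists (L1 ++ L2) => f fg.
by split; [apply/h1|apply/h2]; apply: good_sub fg => u; rewrite mem_cat => ->;
  rewrite ?orbT.
Qed.

Lemma ev_imp P Q : (forall f, P f -> Q f) -> ev P -> ev Q.
Proof. by move=> PQ [L h]; exists L => f /h/PQ. Qed.

Lemma ev_exists P : ev P -> exists f, P f.
Proof. by move=> [L h]; have [f /h] := good_exists L; exists f. Qed.

Lemma evD u v : ev (fun f => f (u + v) = f u + f v).
Proof. by exists [:: u; v] => f [_ _ _]; apply; rewrite !inE eqxx ?orbT. Qed.

Lemma ev0 : ev (fun f => f 0 = 0).
Proof.
by apply: ev_imp (evD 0 0) => f; rewrite addr0 -[X in X = _]addr0 => /addrI.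
Qed.

Lemma evB u v : ev (fun f => f (u - v) = f u - f v).
Proof. by apply: ev_imp (evD (u - v) v) => f; rewrite subrK => ->; rewrite addrK. Qed.

Lemma ev_pos u : nn u -> u <> 0 -> ev (fun f => 0 < f u).
Proof.
by move=> un u0; exists [:: u] => f [_ + _ _]; apply; rewrite ?inE.
Qed.

Lemma ev_K u : ev (fun f => K u (f u)).
Proof. by exists [:: u] => f [+ _ _ _]; apply; rewrite inE. Qed.

Lemma ev_T : ev (fun f => f T = 1).
Proof. by exists [:: T] => f [_ _ + _]; apply; rewrite inE. Qed.

Lemma ev_Tz m : ev (fun f => f (T *~ m) = m).
Proof.
have nat_case (n : nat) : ev (fun f => f (T *~ n) = n).
  elim: n => [|n IH]; first by rewrite mulr0z; exact: ev0.
  apply: ev_imp (ev_and IH (ev_and ev_T (evD T (T *~ n)))) => f [fn [fT fD]].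
  by rewrite intS mulrzDr mulr1z fD fT fn.
case: m => n; first exact: nat_case.
apply: ev_imp (ev_and (nat_case n.+1) (ev_and ev0 (evB 0 (T *~ n.+1)))).
by move=> f [fn [f0 fB]]; rewrite NegzE mulrNz -[- _]add0r fB f0 fn add0r.
Qed.

Lemma ev_le u v : nn (v - u) -> ev (fun f => f u <= f v).
Proof.
move=> uv; have [vu|vu] := EM (v - u = 0).
  by exists [::] => f _; rewrite (subr0_eq vu).
by apply: ev_imp (ev_and (ev_pos uv vu) (evB v u)) => f [fp fB]; lia.
Qed.

Lemma ev_lt u v : ~ nn (u - v) -> ev (fun f => f u < f v).
Proof.
move=> uv; have vu : nn (v - u).
  by case: (disc_total disc (u - v)) => //; rewrite opprB.
have vu0 : v - u <> 0.
  by move=> vu0; apply: uv; rewrite -opprB vu0 oppr0; exact: nn0 disc.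
by apply: ev_imp (ev_and (ev_pos vu vu0) (evB v u)) => f [fp fB]; lia.
Qed.

(** A nonzero difference is positive up to sign, so some [f] would satisfy [f u = f v] and yet be
    nonzero on the difference. *)
Lemma ev_inj u v : ev (fun f => f u = f v) -> u = v.
Proof.
move=> uv; apply/subr0_eq; have [//|vu] := EM (u - v = 0).
have [un|un] := disc_total disc (u - v).
  have [f] := ev_exists (ev_and uv (ev_and (ev_pos un vu) (evB u v))).
  by move=> /= [fuv [+ fB]]; rewrite fB fuv subrr ltxx.
rewrite opprB in un; have vu' : v - u <> 0.
  by rewrite -opprB => /eqP; rewrite oppr_eq0 => /eqP.
have [f] := ev_exists (ev_and uv (ev_and (ev_pos un vu') (evB v u))).
by move=> /= [fuv [+ fB]]; rewrite fB fuv subrr ltxx.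
Qed.

Lemma Tz_inj m n : T *~ m = T *~ n -> m = n.
Proof.
move=> Tmn; have [f [fm fn]] := ev_exists (ev_and (ev_Tz m) (ev_Tz n)).
by rewrite -fm Tmn fn.
Qed.

Lemma nn_Tz m : nn (T *~ m) -> 0 <= m.
Proof.
move=> Tm; rewrite leNgt; apply/negP => m0.
rewrite -[T *~ m]subr0 in Tm.
have [f] := ev_exists (ev_and (ev_Tz m) (ev_and ev0 (ev_le Tm))).
by move=> /= [-> [->]]; rewrite leNgt m0.
Qed.

(** * Transfer of an interpretation over [G] to F_k(Z) *)

Variable interp : term -> G -> G.
Hypothesis interp_var : forall x, exists s (e : int -> int),
  forall u m, K u m -> interp (tvar x) u = u + s + T *~ e m.
Hypothesis interp_mono : forall t u v,
  nn (v - u) -> nn (interp t v - interp t u).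
Hypothesis interp_meet : forall s t u,
  (nn (interp t u - interp s u) -> interp (tmeet s t) u = interp s u) /\
  (nn (interp s u - interp t u) -> interp (tmeet s t) u = interp t u).
Hypothesis interp_join : forall s t u,
  (nn (interp t u - interp s u) -> interp (tjoin s t) u = interp t u) /\
  (nn (interp s u - interp t u) -> interp (tjoin s t) u = interp s u).
Hypothesis interp_mul : forall s t u,
  interp (tmul s t) u = interp s (interp t u).
Hypothesis interp_one : forall u, interp tone u = u.
Hypothesis interp_ladj : forall t u v,
  nn (v - interp (tladj t) u) <-> nn (interp t v - u).
Hypothesis interp_radj : forall t u v,
  nn (interp (tradj t) u - v) <-> nn (u - interp t v).

(** Both [m] and [m + k] are residues of [T *~ m], so [e] is periodic. Monotonicity from [T *~ m] to
    [T *~ (m + 1)] makes [m + e m] nondecreasing. *)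
Lemma interp_var_homo x : exists s (e : int -> int),
  [/\ forall u m, K u m -> interp (tvar x) u = u + s + T *~ e m,
      forall m, e (m + k%:Z) = e m & forall m, e m <= 1 + e (m + 1)].
Proof.
have [s [e eP]] := interp_var x; exists s, e.
have KTn (n : nat) : K (T *~ n) n.
  elim: n => [|n IH]; first by rewrite mulr0z; exact: K0 disc.
  by rewrite intS mulrzDr mulr1z; apply: (disc_KD disc) => //; exact: disc_KT disc.
have KTz m : K (T *~ m) m.
  case: m => // n; rewrite NegzE mulrNz; exact/(disc_KN disc)/KTn.
split=> // m.
  have Kmk : K (T *~ m) (m + k%:Z).
    by rewrite -[T *~ m]addr0; apply: (disc_KD disc) => //; exact: disc_Kk disc.
  have := eP _ _ Kmk; rewrite (eP _ _ (KTz m)) => /addrI/esym; exact: Tz_inj.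
have := @interp_mono (tvar x) (T *~ m) (T *~ (m + 1)).
rewrite (eP _ _ (KTz m)) (eP _ _ (KTz (m + 1))) -mulrzBr.
have -> : m + 1 - m = 1 by lia.
move=> /(_ (disc_Tnn disc)).
have -> : T *~ (m + 1) + s + T *~ e (m + 1) - (T *~ m + s + T *~ e m) =
    T *~ (1 + e (m + 1) - e m).
  have aux (a b c d : G) : a + s + b - (c + s + d) = (a + b) - (c + d).
    by rewrite (addrAC a) (addrAC c) opprD addrACA subrr addr0.
  by rewrite aux -!mulrzDr -mulrzBr; congr (_ *~ _); lia.
by move=> /nn_Tz ?; lia.
Qed.

Lemma not_nnN_T : ~ nn (- T).
Proof. by move=> /(disc_anti disc (disc_Tnn disc)); exact: disc_Tneq0 disc. Qed.

Lemma interp_approx a b : (0 < k)%N -> satisfies (Fn k) (a, b) ->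
  interp a 0 = interp b 0.
Proof.
move=> k0 ab.
have /choice [s /choice [e eP]] := interp_var_homo.
pose g (f : G -> int) x m := m + f (s x) + e x m.
have gk f x m : g f x (m + k%:Z) = g f x m + k%:Z.
  by have [_ ek _] := eP x; rewrite /g ek; lia.
have gs f x m : g f x m <= g f x (m + 1).
  by have [_ _ /(_ m)] := eP x; rewrite /g; lia.
have gFZ f x : is_FZ (g f x) by apply: is_FZ_periodic (gs f x) (gk f x).
pose V f x : FZ := exist _ (g f x) (gFZ f x).
have VFn f x : is_Fn k (V f x) by apply/is_FnP => m; exact: gk.
(* Evaluating [t] at [u] imposes finitely many conditions in [G], so every sufficiently good [f]
   carries it to evaluation in F_k(Z). *)
suff main t u : ev (fun f => sval (eval (V f) t) (f u) = f (interp t u)).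
  apply: ev_inj; apply: ev_imp (ev_and ev0 (ev_and (main a 0) (main b 0))).
  move=> f [f0 [<- <-]].
  have := ab (fun x => exist _ (V f x) (VFn f x) : Fn k).
  by move=> /(congr1 (fun h : Fn k => sval (sval h))); rewrite /= !eval_Fn /= => ->.
elim: t u => [x|t IHt t' IHt'|t IHt t' IHt'|t IHt t' IHt'||t IHt|t IHt] u.
- have [m Km] := disc_Ktot disc u; have [eE ek _] := eP x.
  rewrite (eE _ _ Km); have := ev_and (evD u (s x)) (ev_and
    (evD (u + s x) (T *~ e x m)) (ev_and (ev_Tz (e x m)) (ev_K u))).
  apply: ev_imp => f [fD [fD' [fT Kf]]]; rewrite fD' fD fT /= /g.
  have := eE _ _ Kf; rewrite (eE _ _ Km) => /addrI/Tz_inj ->.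
  by [].
- have := ev_and (IHt u) (IHt' u); have [E1 E2] := interp_meet t t' u.
  have [tt|tt] := disc_total disc (interp t' u - interp t u).
    rewrite E1 // => /(ev_and (ev_le tt)); apply: ev_imp => f [fle [ft ft']].
    by rewrite /= /meet_fun ft ft' min_l.
  rewrite opprB in tt; rewrite E2 // => /(ev_and (ev_le tt)).
  by apply: ev_imp => f [fle [ft ft']]; rewrite /= /meet_fun ft ft' min_r.
- have := ev_and (IHt u) (IHt' u); have [E1 E2] := interp_join t t' u.
  have [tt|tt] := disc_total disc (interp t' u - interp t u).
    rewrite E1 // => /(ev_and (ev_le tt)); apply: ev_imp => f [fle [ft ft']].
    by rewrite /= /join_fun ft ft' max_r.
  rewrite opprB in tt; rewrite E2 // => /(ev_and (ev_le tt)).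
  by apply: ev_imp => f [fle [ft ft']]; rewrite /= /join_fun ft ft' max_l.
- have := ev_and (IHt' u) (IHt (interp t' u)); rewrite interp_mul.
  by apply: ev_imp => f [ft' ft]; rewrite /= ft'.
- by exists [::] => f _; rewrite interp_one.
(* Here [p] is the least point with [u <= t p]. As [p - T] is the predecessor of [p], this amounts
   to two sign conditions, and they suffice in the integers because [f T = 1]. *)
- set p := interp _ u.
  have tp : nn (interp t p - u).
    by apply/interp_ladj; rewrite subrr; exact: nn0 disc.
  have tpT : ~ nn (interp t (p - T) - u).
    by move=> /interp_ladj; rewrite addrAC subrr add0r; exact: not_nnN_T.
  have := ev_and (ev_and (ev_le tp) (ev_lt tpT)) (ev_and (ev_and (IHt p)
    (IHt (p - T))) (ev_and ev_T (evB p T))).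
  apply: ev_imp => f [[f1 f2] [[f3 f4] [f5 f6]]].
  rewrite f6 f5 in f4; apply/eqP; rewrite eq_le FZ_ladj_galois f3 f1 /=.
  rewrite leNgt; apply/negP => lt; have : sval (eval (V f) (tladj t)) (f u) <= f p - 1.
    by rewrite -ltzD1 subrK.
  by rewrite FZ_ladj_galois f4 leNgt f2.
- set p := interp _ u.
  have tp : nn (u - interp t p).
    by apply/interp_radj; rewrite subrr; exact: nn0 disc.
  have tpT : ~ nn (u - interp t (p + T)).
    by move=> /interp_radj; rewrite opprD addNKr; exact: not_nnN_T.
  have := ev_and (ev_and (ev_le tp) (ev_lt tpT)) (ev_and (ev_and (IHt p)
    (IHt (p + T))) (ev_and ev_T (evD p T))).
  apply: ev_imp => f [[f1 f2] [[f3 f4] [f5 f6]]].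
  rewrite f6 f5 in f4; apply/eqP; rewrite eq_le FZ_radj_galois f3 f1 andbT.
  rewrite leNgt; apply/negP => lt; have : f p + 1 <= sval (eval (V f) (tradj t)) (f u).
    by rewrite lezD1.
  by rewrite FZ_radj_galois f4 leNgt f2.
Qed.

End Approximation.

(** * Prime filters and actions on chains *)

Lemma prime_filter (A : algebra) (s t : A) : DLP A -> ~ s <== t ->
  exists F : set A, [/\ F s, ~ F t, forall a b, F a -> a <== b -> F b,
    forall a b, F a -> F b -> F (meet a b)
  & forall a b, F (join a b) -> F a \/ F b].
Proof.
move=> [lpA dA] st.
(* The first clause, in place of [F s], admits the empty set, which is the union of the empty
   chain. *)
pose filt (F : set A) := [/\ forall a, F a -> F s, ~ F t,
  forall a b, F a -> a <== b -> F b & forall a b, F a -> F b -> F (meet a b)].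
have [|F [[Fs Ft Fup FI] Fmax]] := @Zorn_bigcup A filt.
  move=> C CP Ctot.
  split=> [a [D CD Da]|[D CD Dt]|a b [D CD Da] ab|a b [D CD Da] [E CE Eb]].
  - by exists D => //; have [+ _ _ _] := CP _ CD; apply; exact: Da.
  - by have [_ + _ _] := CP _ CD.
  - by exists D => //; have [_ _ + _] := CP _ CD; apply; [exact: Da|exact: ab].
  - have [DE|ED] := Ctot D E CD CE.
      by exists E => //; have [_ _ _] := CP _ CE; apply => //; exact: DE.
    by exists D => //; have [_ _ _] := CP _ CD; apply => //; exact: ED.
have max_ext (G : set A) : filt G -> F `<=` G -> G `<=` F.
  move=> Gf FG; apply: contrapT => GF; exact: (Fmax G).
have sF : F s.
  apply: contrapT => nFs.
  have F0 a : ~ F a by move=> /Fs.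
  apply/nFs/(max_ext [set a | s <== a]) => [|a /F0//|]; last exact: lp_refl.
  split => // [a _|a b sa ab|a b]; [exact: lp_refl|exact: lp_trans ab|exact: lp_glb].
(* By maximality, the filter generated by [F] and an element outside it contains [t]. *)
have ext a : ~ F a -> exists2 f, F f & meet f a <== t.
  move=> Fa; apply: contrapT => h; apply: Fa.
  apply: (max_ext [set x | exists2 f, F f & meet f a <== x]) => /=.
  - split => [x _|[f Ff ft]|x y [f Ff fx] xy|x y [f Ff fx] [g Fg gy]].
    + by exists s => //; exact: lp_meetl.
    + by apply: h; exists f.
    + by exists f => //; apply: lp_trans xy.
    + have Ffg := FI _ _ Ff Fg; exists (meet f g) => //=.
      apply: lp_glb => //; [apply: (lp_trans lpA _ fx)|apply: (lp_trans lpA _ gy)];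
        apply: lp_glb => //; do ?exact: lp_meetr; apply: (lp_trans lpA (lp_meetl lpA _ _));
        [exact: lp_meetl|exact: lp_meetr].
  - by move=> x Fx; exists x => //; exact: lp_meetl.
  - by exists s => //; exact: lp_meetr.
exists F; split => // a b Fab.
have [Fa|/ext[f Ff fa]] := EM (F a); first by left.
have [Fb|/ext[g Fg gb]] := EM (F b); first by right.
exfalso; apply: Ft; apply: (Fup (meet (join a b) (meet f g))).
  exact: FI Fab (FI _ _ Ff Fg).
rewrite dA; apply: lp_lub => //.
- apply: lp_trans fa => //; apply: lp_glb => //; last exact: lp_meetl.
  by apply: (lp_trans lpA (lp_meetr lpA _ _)); exact: lp_meetl.
- apply: lp_trans gb => //; apply: lp_glb => //; last exact: lp_meetl.
  by apply: (lp_trans lpA (lp_meetr lpA _ _)); exact: lp_meetr.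
Qed.

(* An order-preserving action of [A] on a chain, given by a total preorder on
   the orbit of a point [p]: [R a b] means that [a p <= b p]. *)
Record point_order (A : algebra) (R : A -> A -> Prop) : Prop := {
  po_total : forall a b, R a b \/ R b a;
  po_trans : forall b a c, R a b -> R b c -> R a c;
  po_le : forall a b, a <== b -> R a b;
  po_mull : forall c a b, R a b -> R (c ** a) (c ** b);
  po_meet : forall a b c, R c a -> R c b -> R c (meet a b);
  po_join : forall a b c, R a c -> R b c -> R (join a b) c }.

(** The point [a p] is the set of all [c] with [c ** a] in the prime filter [F], and points are
    compared by inclusion. *)
Lemma point_order_exists (A : algebra) (s t : A) : DLP A -> ~ s <== t ->
  exists R : A -> A -> Prop, point_order R /\ ~ R s t.
Proof.
move=> DA st; have [lpA dA] := DA.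
have [F [Fs Ft Fup FI FU]] := prime_filter DA st.
exists (fun a b => forall c, F (c ** a) -> F (c ** b)); split; last first.
  by move=> /(_ one); rewrite !lp_mul1 // => /(_ Fs).
split => [a b|b a c ab bc d /ab/bc //|a b ab c|c a b ab d|a b c ca cb d|a b c ac bc d].
- have [|/existsNP[c /not_implyP[Fca Fcb]]] :=
    EM (forall c, F (c ** a) -> F (c ** b)); first by left.
  (* If [c] and [d] witnessed both failures of inclusion, [F] would contain [join c d ** meet a b],
     hence by primeness [c ** b] or [d ** a]. *)
  right=> d Fdb; apply: contrapT => Fda.
  have Fm : F (join c d ** meet a b).
    rewrite lp_mulIl //; apply: FI.
    + by apply: Fup Fca _; apply: lp_mul2r => //; exact: lp_joinl.
    + by apply: Fup Fdb _; apply: lp_mul2r => //; exact: lp_joinr.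
  move: Fm; rewrite lp_mulUr // => /FU[] /Fup h.
  + by apply: Fcb; apply: h; apply: lp_mul2l => //; exact: lp_meetr.
  + by apply: Fda; apply: h; apply: lp_mul2l => //; exact: lp_meetl.
- by move/Fup; apply; apply: lp_mul2l.
- by rewrite !lp_mulA //; exact: ab.
- by move=> Fdc; rewrite lp_mulIl //; apply: FI; [exact: ca|exact: cb].
- by rewrite lp_mulUl // => /FU[/ac|/bc].
Qed.

Section PointOrder.

Variables (A : algebra) (R : A -> A -> Prop).
Hypothesis lpA : is_lpregroup A.
Hypothesis poR : point_order R.
Implicit Types a b c p q : A.

Lemma po_refl a : R a a.
Proof. by case: (po_total poR a a). Qed.

Lemma po_notle a b : ~ R a b -> R b a.
Proof. by case: (po_total poR a b). Qed.

Lemma po_mulr a b p : a <== b -> R (a ** p) (b ** p).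
Proof. by move=> ab; apply/(po_le poR)/lp_mul2r. Qed.

Lemma po_ladjP a p q : R (ladj a ** p) q <-> R p (a ** q).
Proof.
split=> [/(po_mull poR a)|/(po_mull poR (ladj a))]; rewrite lp_mulA //.
  apply: (po_trans poR); rewrite -{1}(lp_mul1 lpA p).
  exact/po_mulr/(ladj_ge1_ax lpA).
move=> h; apply: (po_trans poR h); rewrite -{2}(lp_mul1 lpA q).
exact/po_mulr/(ladj_le1_ax lpA).
Qed.

Lemma po_radjP a p q : R (a ** p) q <-> R p (radj a ** q).
Proof.
split=> [/(po_mull poR (radj a))|/(po_mull poR a)]; rewrite lp_mulA //.
  apply: (po_trans poR); rewrite -{1}(lp_mul1 lpA p).
  exact/po_mulr/(radj_ge1_ax lpA).
move=> h; apply: (po_trans poR h); rewrite -{2}(lp_mul1 lpA q).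
exact/po_mulr/(radj_le1_ax lpA).
Qed.

Lemma po_join_prime p a b : R p (join a b) -> R p a \/ R p b.
Proof.
move=> h; have [ab|ba] := po_total poR a b; [right|left];
  by apply: (po_trans poR h); apply: po_join => //; exact: po_refl.
Qed.

Lemma po_meet_prime p a b : R (meet a b) p -> R a p \/ R b p.
Proof.
move=> h; have [ab|ba] := po_total poR a b; [left|right];
  by apply: (po_trans poR _ h); apply: po_meet => //; exact: po_refl.
Qed.

Lemma po_bjoin_prime (f : nat -> A) n c p :
  R p (bjoin f n ** c) -> exists2 i, (i <= n)%N & R p (f i ** c).
Proof.
elim: n => [|n IH] /=; first by exists 0.
rewrite lp_mulUr // => /po_join_prime[/IH[i ni]|]; last by exists n.+1.
by exists i => //; exact: leqW.
Qed.

Lemma po_bjoin_le (f : nat -> A) n c p :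
  (forall i, R (f i ** c) p) -> R (bjoin f n ** c) p.
Proof.
by move=> fp; elim: n => //= n IH; rewrite lp_mulUr //; exact: po_join.
Qed.

Lemma po_bmeet_prime (f : nat -> A) n c p :
  R (bmeet f n ** c) p -> exists2 i, (i <= n)%N & R (f i ** c) p.
Proof.
elim: n => [|n IH] /=; first by exists 0.
rewrite lp_mulIr // => /po_meet_prime[/IH[i ni]|]; last by exists n.+1.
by exists i => //; exact: leqW.
Qed.

End PointOrder.

Definition valuation (A : algebra) (x y z w : nat -> A) (i : var) : A :=
  match i with vx n => x n | vy n => y n | vz n => z n | vw n => w n end.

(* The value of the bracketed part of [summand k]. *)
Definition bracket (A : algebra) (k : nat) (x y z : A) : A :=
  let s := pow (bmeet (fun j => iter j (@shift A) y) k.-1) k in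
  meet (iter k (@shift A) z ** ladj z) (s ** x ** ladj s ** ladj x).

Lemma eval_summand (A : algebra) (lpA : is_lpregroup A) (v : var -> A) k :
  (0 < k)%N -> eval v (summand k) =
  v (vw k) ** bracket k (v (vx k)) (v (vy k)) (v (vz k)) ** ladj (v (vw k)).
Proof.
case: k => // k _; rewrite /summand; cbn zeta.
set t := sigma _ _; rewrite [LHS]/=.
rewrite -[eval v (texp t k.+1)]/(eval v (texp t k.+1)) eval_texp // /t eval_sigma.
rewrite /bracket; congr (_ ** meet _ _ ** _); congr (_ ** _).
exact: (eval_tshift v k.+1 (tvar (vz k.+1))).
Qed.

Lemma foldl_tjoin_prime (A : algebra) (R : A -> A -> Prop) (v : var -> A)
    (f : nat -> term) t s p :
  is_lpregroup A -> point_order R -> R p (eval v (foldl tjoin t [seq f k | k <- s])) ->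
  R p (eval v t) \/ exists2 k, k \in s & R p (eval v (f k)).
Proof.
move=> lpA poR; elim: s t => [|k s IH] t /=; first by left.
move=> /IH[/=/(po_join_prime poR)[|]|[i si ip]]; first by left.
  by right; exists k; rewrite ?mem_head.
by right; exists i; rewrite // inE si orbT.
Qed.

(** Distinct brackets have disjoint variables, so counterexamples for all [k] fit into one
    valuation, and in a chain a join lies above a point only if some joinand does. *)
Lemma join_equation_bracket (A : algebra) (R : A -> A -> Prop) (S : {fset nat}) :
  S != fset0 -> (forall k, k \in S -> (0 < k)%N) ->
  is_lpregroup A -> satisfies A (join_equation S) -> point_order R ->
  exists2 k, k \in S & forall x y z p, R p (bracket k x y z ** p).
Proof.
move=> S0 Spos lpA AS poR; apply: contrapT => h.
have bad k : exists X, k \in S ->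
    ~ R X.2 (bracket k X.1.1.1 X.1.1.2 X.1.2 ** X.2).
  have [kS|kS] := boolP (k \in S); last by exists (one, one, one, one).
  apply: contrapT => h'; apply: h; exists k => // x y z p; apply: contrapT => hp.
  by apply: h'; exists (x, y, z, p).
have /choice[X XP] := bad.
(* With [w_k = radj p] and hence [w_k^l = p], the summand at the base point tests the bracket at the
   point of [p]. *)
pose v := valuation (fun k => (X k).1.1.1) (fun k => (X k).1.1.2)
  (fun k => (X k).1.2) (fun k => radj (X k).2).
have : R one (eval v (tbigjoin [seq summand k | k <- enum_fset S])).
  by apply: (po_le poR); exact: AS v.
have main k : k \in S -> ~ R one (eval v (summand k)).
  move=> kS; rewrite eval_summand //; last exact: Spos.
  rewrite /= lp_radjK // => hk; apply: (XP k kS).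
  by rewrite -{1}(lp_mulr1 lpA (X k).2) (po_radjP lpA poR) lp_mulA.
have SE k : (k \in enum_fset S) = (k \in S) by [].
case: (enum_fset S) SE => [|k s] SE.
  by case/negP: S0; apply/eqP/fsetP=> k; rewrite -SE.
case/(foldl_tjoin_prime lpA poR) => [|[i si]].
  by apply: main; rewrite -SE mem_head.
by apply: main; rewrite -SE inE si orbT.
Qed.

(** * Faithful quotient *)

Definition faithful (A : algebra) (R : A -> A -> Prop) : Prop :=
  forall a b : A, (forall c, R (a ** c) (b ** c) /\ R (b ** c) (a ** c)) -> a = b.

Section FaithfulQuotient.

Variables (A : algebra) (R : A -> A -> Prop).
Hypothesis lpA : is_lpregroup A.
Hypothesis poR : point_order R.
Implicit Types a b c : A.

Definition peq a b : Prop := forall c, R (a ** c) (b ** c) /\ R (b ** c) (a ** c).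

Lemma peq_refl a : peq a a.
Proof. by move=> c; split; exact: po_refl. Qed.

Lemma peq_sym a b : peq a b -> peq b a.
Proof. by move=> ab c; have [] := ab c. Qed.

Lemma peq_trans b a c : peq a b -> peq b c -> peq a c.
Proof.
move=> ab bc d; have [ab1 ab2] := ab d; have [bc1 bc2] := bc d.
by split; [exact: po_trans ab1 bc1 | exact: po_trans bc2 ab2].
Qed.

Lemma peq_meet a a' b b' : peq a a' -> peq b b' -> peq (meet a b) (meet a' b').
Proof.
have half x x' y y' : peq x x' -> peq y y' ->
    forall c, R (meet x y ** c) (meet x' y' ** c).
  move=> xx yy c; have [x1 _] := xx c; have [y1 _] := yy c.
  rewrite !lp_mulIr //; apply: po_meet => //.
    by apply: po_trans x1 => //; apply/(po_le poR)/lp_meetl.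
  by apply: po_trans y1 => //; apply/(po_le poR)/lp_meetr.
by move=> aa bb c; split; apply: half => //; exact: peq_sym.
Qed.

Lemma peq_join a a' b b' : peq a a' -> peq b b' -> peq (join a b) (join a' b').
Proof.
have half x x' y y' : peq x x' -> peq y y' ->
    forall c, R (join x y ** c) (join x' y' ** c).
  move=> xx yy c; have [x1 _] := xx c; have [y1 _] := yy c.
  rewrite !lp_mulUr //; apply: po_join => //.
    by apply: (po_trans poR x1); apply/(po_le poR)/lp_joinl.
  by apply: (po_trans poR y1); apply/(po_le poR)/lp_joinr.
by move=> aa bb c; split; apply: half => //; exact: peq_sym.
Qed.

Lemma peq_mul a a' b b' : peq a a' -> peq b b' -> peq (a ** b) (a' ** b').
Proof.
move=> aa bb; apply: (@peq_trans (a ** b')) => c; rewrite -!lp_mulA //.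
by have [b1 b2] := bb c; split; exact: po_mull.
Qed.

Lemma peq_ladj a a' : peq a a' -> peq (ladj a) (ladj a').
Proof.
have half x x' c : peq x x' -> R (ladj x ** c) (ladj x' ** c).
  move=> xx; apply/po_ladjP => //; have [_] := xx (ladj x' ** c).
  by apply: po_trans => //; apply/po_ladjP => //; exact: po_refl.
by move=> aa c; split; apply: half => //; exact: peq_sym.
Qed.

Lemma peq_radj a a' : peq a a' -> peq (radj a) (radj a').
Proof.
have half x x' c : peq x x' -> R (radj x ** c) (radj x' ** c).
  move=> xx; apply/(po_radjP lpA poR x'); have [_ h] := xx (radj x ** c).
  by apply: (po_trans poR h); apply/(po_radjP lpA poR x); exact: po_refl.
by move=> aa c; split; apply: half => //; exact: peq_sym.
Qed.

(* Classes have type [A -> Prop] rather than [set A], whose universe is too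
   large for the carrier of an [algebra]. *)
Definition quot : Type := {C : A -> Prop | exists a, C = peq a}.

Definition quot_pi a : quot := exist _ (peq a) (ex_intro _ a erefl).

Definition quot_repr (q : quot) : A := projT1 (cid (svalP q)).

Lemma quot_reprK q : quot_pi (quot_repr q) = q.
Proof.
case: q => C aC; apply: eq_exist; rewrite /quot_repr; case: cid => a /= E.
exact/esym.
Qed.

Lemma quot_piP a b : quot_pi a = quot_pi b <-> peq a b.
Proof.
split=> [/(congr1 sval)/= ab|ab].
  by have : peq b b; [exact: peq_refl | rewrite -ab].
apply: eq_exist; apply/funext => c; apply/propext; split; last exact: peq_trans.
by apply: peq_trans; exact: peq_sym.
Qed.

Lemma quot_piK a : peq (quot_repr (quot_pi a)) a.
Proof. by apply/quot_piP; rewrite quot_reprK. Qed.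

Definition quot_algebra : algebra := @Algebra quot
  (fun p q => quot_pi (meet (quot_repr p) (quot_repr q)))
  (fun p q => quot_pi (join (quot_repr p) (quot_repr q)))
  (fun p q => quot_pi (quot_repr p ** quot_repr q))
  (quot_pi one)
  (fun p => quot_pi (ladj (quot_repr p)))
  (fun p => quot_pi (radj (quot_repr p))).

Lemma quot_pi_hom : @is_hom A quot_algebra quot_pi.
Proof.
split=> // [a b|a b|a b|a|a]; apply/quot_piP.
- by apply: peq_meet; apply/peq_sym/quot_piK.
- by apply: peq_join; apply/peq_sym/quot_piK.
- by apply: peq_mul; apply/peq_sym/quot_piK.
- by apply: peq_ladj; apply/peq_sym/quot_piK.
- by apply: peq_radj; apply/peq_sym/quot_piK.
Qed.

Definition quot_order (p q : quot_algebra) : Prop := R (quot_repr p) (quot_repr q).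

Lemma quot_orderE a b : quot_order (quot_pi a) (quot_pi b) <-> R a b.
Proof.
have [a1 a2] := quot_piK a one; have [b1 b2] := quot_piK b one.
rewrite !lp_mulr1 // in a1 a2 b1 b2.
split=> ab; first exact: (po_trans poR a2 (po_trans poR ab b1)).
exact: (po_trans poR a1 (po_trans poR ab b2)).
Qed.

Lemma quot_point_order : point_order quot_order.
Proof.
have rs (q : quot_algebra) : exists a, q = quot_pi a.
  by exists (quot_repr q); rewrite quot_reprK.
have [hI hU hM h1 hl hr] := quot_pi_hom.
split.
- by move=> p q; exact: po_total poR _ _.
- by move=> q p r; exact: (po_trans poR).
- move=> p q; have [[a ->] [b ->]] := (rs p, rs q).
  rewrite /le -hI => /quot_piP ab; apply/quot_orderE.
  have [+ _] := ab one; rewrite !lp_mulr1 // => /(po_trans poR); apply.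
  exact/(po_le poR)/lp_meetr.
- move=> r p q; have [[c ->] [[a ->] [b ->]]] := (rs r, (rs p, rs q)).
  by rewrite -!hM !quot_orderE; exact: (po_mull poR).
- move=> p q r; have [[c ->] [[a ->] [b ->]]] := (rs r, (rs p, rs q)).
  by rewrite -!hI !quot_orderE; exact: (po_meet poR).
- move=> p q r; have [[c ->] [[a ->] [b ->]]] := (rs r, (rs p, rs q)).
  by rewrite -!hU !quot_orderE; exact: (po_join poR).
Qed.

Lemma quot_faithful : faithful quot_order.
Proof.
have [hI hU hM h1 hl hr] := quot_pi_hom.
move=> p q pq; rewrite -(quot_reprK p) -(quot_reprK q); apply/quot_piP => c.
have := pq (quot_pi c); rewrite -{1 2}(quot_reprK p) -{1 2}(quot_reprK q) -!hM.
by rewrite !quot_orderE.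
Qed.

Lemma quot_DLP : DLP A -> DLP quot_algebra.
Proof.
rewrite DLP_modelsE => mA e eD.
exact: satisfies_hom_surj quot_pi_hom quot_reprK (mA e eD).
Qed.

End FaithfulQuotient.

(** * Invertible elements of a faithful action *)

Section Core.

Variables (A : algebra) (R : A -> A -> Prop) (k : nat).
Hypothesis lpA : is_lpregroup A.
Hypothesis poR : point_order R.
Hypothesis fR : faithful R.
Hypothesis brk : forall x y z : A, one <== bracket k.+1 x y z.
Implicit Types a b c g h p q r x y z : A.

Notation sigma_ b := (bmeet (fun j => iter j (@shift A) b) k).
Notation tau_ b := (bjoin (fun j => iter j (@shift A) b) k).

(** The first half of the bracket gives [a <= a^[k+1]]; at [a = z^l] this reverses to [z^[k+1] <=
    z]. *)
Lemma core_periodic z : iter k.+1 (@shift A) z = z.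
Proof.
have inc a : a <== iter k.+1 (@shift A) a.
  have /(lp_le_meet lpA)[+ _] := brk one one a.
  by rewrite -(lp_ladjPr lpA) (lp_mul1 lpA).
apply: (lp_anti lpA) => //; apply/(lp_le_ladj lpA).
have -> : ladj (iter k.+1 (@shift A) z) = iter k.+1 (@shift A) (ladj z).
  by elim: k.+1 => //= n; rewrite /shift => ->.
exact: inc.
Qed.

Let per := core_periodic.

Lemma bmeet_fix h : shift h = h -> sigma_ h = h.
Proof.
move=> hh; apply: (lp_anti lpA).
  by have /(le_bmeet lpA)/(_ 0 (leq0n k)) := lp_refl lpA (sigma_ h).
apply/(le_bmeet lpA) => i _; rewrite iter_shift_fix //; exact: lp_refl.
Qed.

Lemma sigma_inv b : shift (sigma_ b) = sigma_ b.
Proof. exact: bmeet_shift_fix. Qed.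

Lemma tau_inv b : shift (tau_ b) = tau_ b.
Proof. exact: bjoin_shift_fix. Qed.

(** At an invertible [h] the second half of the bracket reads [x h^(k+1) <= h^(k+1) x]. Applied to
    the inverse of [h], it gives the converse. *)
Lemma pow_central h x : shift h = h -> pow h k.+1 ** x = x ** pow h k.+1.
Proof.
have half g : shift g = g -> x ** pow g k.+1 <== pow g k.+1 ** x.
  move=> gg; have /(lp_le_meet lpA)[_] := brk x g one.
  rewrite [k.+1.-1]/= (bmeet_fix gg) -(lp_ladjPr lpA) (lp_mul1 lpA).
  by rewrite (lp_ladjPr lpA).
move=> hh; apply: (lp_anti lpA); last exact: half.
have := half _ (shift_ladj_fix hh); rewrite -ladj_pow //.
set P := pow h k.+1; have PP : shift P = P by exact: shift_pow_fix.
move=> /(lp_mul2l lpA P) /(lp_mul2r lpA P).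
rewrite !(lp_mulA lpA) inv_mulV // (lp_mul1 lpA) -!(lp_mulA lpA).
by rewrite inv_mulKl // (lp_mulr1 lpA).
Qed.

(** The direction of the first step propagates along the sequence, so a return to the start forces
    equality at that step. *)
Lemma periodic_orbit (u : nat -> A) n :
  (forall i j, R (u i) (u j) -> R (u i.+1) (u j.+1)) -> u n.+1 = u 0 ->
  R (u 0) (u 1) /\ R (u 1) (u 0).
Proof.
move=> step un; have [u01|u10] := po_total poR (u 0) (u 1); split => //.
- have inc i : R (u i) (u i.+1) by elim: i => // i; exact: step.
  rewrite -un; elim: n {un} => [|n IH]; first exact: po_refl.
  exact: (po_trans poR IH (inc _)).
- have dec i : R (u i.+1) (u i) by elim: i => // i; exact: step.
  rewrite -{1}un; elim: n {un} => [|n IH]; first exact: po_refl.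
  exact: (po_trans poR (dec _) IH).
Qed.

(* A finite-order automorphism of a chain is trivial. *)
Lemma automorphism_id (f : A -> A) : f one = one ->
  (forall a b, a <== b -> f a <== f b) -> (forall a b, f (a ** b) = f a ** f b) ->
  (forall a, iter k.+1 f a = a) -> (forall a, R one a -> R one (f a)) ->
  forall a, f a = a.
Proof.
move=> f1 fle fM fk fR1.
(* [R a b] says that [radj a ** b] is at least 1 at the base point, so preserving that cone
   suffices. *)
have fmono a b : R a b -> R (f a) (f b).
  rewrite -{1}(lp_mulr1 lpA a) (po_radjP lpA poR) => /fR1.
  rewrite fM => /(po_mull poR (f a)); rewrite (lp_mulr1 lpA) (lp_mulA lpA) -fM.
  move=> h; apply: (po_trans poR h); rewrite -{2}(lp_mul1 lpA (f b)) -f1.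
  by apply: po_mulr => //; apply: fle; exact: radj_le1_ax.
have fE a : R a (f a) /\ R (f a) a.
  by apply: (periodic_orbit (u := fun i => iter i f a) (n := k)) => // i j; exact: fmono.
move=> a; apply: fR => c.
have [ac1 ac2] := fE (a ** c); have [c1 c2] := fE c.
split.
  by apply: (po_trans poR (po_mull poR (f a) c1)); rewrite -fM.
by apply: (po_trans poR ac1); rewrite fM; exact: po_mull.
Qed.

(** * Conjugation by invertible elements *)

Definition conjugate h a : A := ladj h ** a ** h.

Section Conjugation.

Variable h : A.
Hypothesis hh : shift h = h.

Lemma conj1 : conjugate h one = one.
Proof. by rewrite /conjugate (lp_mulr1 lpA) inv_mulKl. Qed.

Lemma conjM a b : conjugate h (a ** b) = conjugate h a ** conjugate h b.
Proof.
rewrite /conjugate !(lp_mulA lpA); congr (_ ** _ ** _).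
by rewrite -[RHS](lp_mulA lpA) inv_mulV // (lp_mulr1 lpA).
Qed.

Lemma conj_le a b : a <== b -> conjugate h a <== conjugate h b.
Proof. by move=> ab; apply/(lp_mul2r lpA)/(lp_mul2l lpA). Qed.

Lemma conj_shift a : conjugate h (shift a) = shift (conjugate h a).
Proof. by rewrite /conjugate !(shiftM lpA) hh (shift_ladj_fix hh). Qed.

Lemma iter_conj n a : iter n (conjugate h) a = ladj (pow h n) ** a ** pow h n.
Proof.
elim: n => [|n IH]; first by rewrite /= lp_ladj1 // (lp_mulr1 lpA) (lp_mul1 lpA).
rewrite iterS IH /conjugate (powSr lpA) (lp_ladjM lpA) -!(lp_mulA lpA).
by congr (_ ** (_ ** _)).
Qed.

Lemma iter_conj_period a : iter k.+1 (conjugate h) a = a.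
Proof.
rewrite iter_conj -(lp_mulA lpA) -pow_central // (lp_mulA lpA).
rewrite inv_mulKl ?(lp_mul1 lpA) //.
exact: shift_pow_fix.
Qed.

Lemma conj_fix_pow g : shift g = g -> pow (conjugate h g) k.+1 = pow g k.+1.
Proof.
move=> gg; have -> : pow (conjugate h g) k.+1 = conjugate h (pow g k.+1).
  by elim: k.+1 => [|n IH]; rewrite ?conj1 // !powS IH conjM.
rewrite /conjugate -(lp_mulA lpA) pow_central // (lp_mulA lpA) inv_mulKl //.
by rewrite (lp_mul1 lpA).
Qed.

Lemma conj_fix_inv g : shift g = g -> shift (conjugate h g) = conjugate h g.
Proof. by move=> gg; rewrite -conj_shift gg. Qed.

(** If the conjugate moved [b] strictly down, so would its power of exponent [k.+1]. By centrality
    this is the power of [g], which does not. *)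
Lemma conj_fix_ge1 g b : shift g = g -> R b (g ** b) -> R b (conjugate h g ** b).
Proof.
move=> gg gb; apply: contrapT => ngb.
have gb' : R (conjugate h g ** b) b by exact: po_notle.
apply: ngb; have pg n : R b (pow g n ** b).
  elim: n => [|n IH]; first by rewrite /= (lp_mul1 lpA); exact: po_refl.
  apply: (po_trans poR gb); rewrite powS -(lp_mulA lpA); exact: po_mull.
have pc n : R (pow (conjugate h g) n.+1 ** b) (conjugate h g ** b).
  elim: n => [|n IH]; first by rewrite powS /= (lp_mulr1 lpA); exact: po_refl.
  rewrite powS -(lp_mulA lpA); apply: po_mull => //.
  exact: (po_trans poR IH).
by apply: (po_trans poR (pg k.+1)); rewrite -conj_fix_pow.
Qed.

Lemma po_inv_mul b c : R (h ** b) c <-> R b (ladj h ** c).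
Proof.
split=> [/(po_mull poR (ladj h))|/(po_mull poR h)];
  by rewrite !(lp_mulA lpA) ?inv_mulKl ?inv_mulV // (lp_mul1 lpA).
Qed.

End Conjugation.

(** By [conj_fix_ge1], conjugation by [h] preserves the order of invertible elements at every point.
    Having finite order, it fixes them all. *)
Lemma inv_comm g h : shift g = g -> shift h = h -> g ** h = h ** g.
Proof.
move=> gg hh; have E : conjugate h g = g.
  have iter_inv n : shift (iter n (conjugate h) g) = iter n (conjugate h) g.
    by elim: n => //= n IH; rewrite conj_fix_inv.
  apply: fR => b; have [] := @periodic_orbit (fun n => iter n (conjugate h) g ** b) k.
  - move=> i j /(po_inv_mul (iter_inv i)); set x := iter i _ _; set y := iter j _ _.
    rewrite (lp_mulA lpA) => /(conj_fix_ge1 hh) xy.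
    have xx : shift x = x by exact: iter_inv.
    have /xy : shift (ladj x ** y) = ladj x ** y.
      by rewrite (shiftM lpA) (shift_ladj_fix xx) iter_inv.
    move=> /(po_mull poR (conjugate h x)).
    by rewrite (lp_mulA lpA) -conjM // (lp_mulA lpA) inv_mulV // (lp_mul1 lpA).
  - by rewrite iter_conj_period.
  - by [].
by rewrite -{2}E /conjugate !(lp_mulA lpA) inv_mulV // (lp_mul1 lpA).
Qed.

(* If every [c] had a counterexample [w c], then their meet [a] would satisfy
   [1 <= a] at the point, hence [1 <= tau a = h^-1 (tau a) h], although all the
   shifted conjugates of [a] whose join this is are below 1 there. *)
Lemma conj_is_shift h : shift h = h ->
  exists c : nat, forall a, iter c (@shift A) (conjugate h a) = a.
Proof.
move=> hh; pose f (c : nat) a := iter c (@shift A) (conjugate h a).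
(* If some [f c] preserves the positive cone of the base point, it is an automorphism whose iterate
   of order [k.+1] is trivial, hence the identity. *)
have [[c fc]|no] := EM (exists c : nat, forall a, R one a -> R one (f c a)).
  exists c; apply: automorphism_id => //.
  - by rewrite conj1 // iter_shift_fix // shift1.
  - by move=> a b ab; apply/iter_shift_le/conj_le.
  - by move=> a b; rewrite conjM // iter_shiftM.
  - move=> a; have fE n :
        iter n (f c) a = iter (c * n) (@shift A) (iter n (conjugate h) a).
      elim: n => [|n IH]; first by rewrite muln0.
      rewrite !iterS IH /f mulnS iterD; congr iter.
      by elim: (c * n)%N => //= m <-; rewrite conj_shift.
    rewrite -/(f c) fE iter_conj_period //.
    by elim: c {fc fE} => // c IH; rewrite mulSn iterD IH per.
have /choice[w wP] : forall c : nat, exists a, R one a /\ ~ R one (f c a).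
  move=> c; apply: contrapT => ne; apply: no; exists c => a oa.
  by apply: contrapT => nfa; apply: ne; exists a.
pose a := bmeet w k; exfalso.
have oa : R one a.
  rewrite /a; elim: k => /= [|n IH]; first by case: (wP 0%N).
  by apply: po_meet => //; case: (wP n.+1).
have : R one (tau_ a).
  apply: (po_trans poR oa); apply: (po_le poR).
  by have /(bjoin_le lpA)/(_ 0 (leq0n k)) := lp_refl lpA (tau_ a).
have -> : tau_ a = bjoin (fun c : nat => f c a) k.
  have : conjugate h (tau_ a) = tau_ a.
    rewrite /conjugate -(lp_mulA lpA) (inv_comm (tau_inv a) hh) (lp_mulA lpA).
    by rewrite inv_mulKl // (lp_mul1 lpA).
  move=> <-; rewrite /conjugate bjoin_conj //; apply: eq_bjoin => c.
  rewrite -/(conjugate h _) /f.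
  by elim: c => //= c <-; rewrite conj_shift.
rewrite -(lp_mulr1 lpA (bjoin _ _)) => /(po_bjoin_prime lpA poR)[c ck].
rewrite (lp_mulr1 lpA); have [_ nc] := wP c; move=> ofc; apply: nc.
apply: (po_trans poR ofc); apply: (po_le poR); apply/iter_shift_le/conj_le => //.
by have /(le_bmeet lpA) := lp_refl lpA a; apply.
Qed.

(* If [x p < x^[1] p], then [x^[1] p] covers [x p]. *)
Lemma shift_cover x p q : ~ R q (x ** p) -> R (shift x ** p) q.
Proof.
move=> qx; apply/(po_ladjP lpA poR); apply: po_notle => // h.
by apply: qx; apply/(po_ladjP lpA poR).
Qed.

(** Otherwise every element would decrease under [shift], and periodicity would make it constant. *)
Lemma shift_moves x : shift x <> x ->
  exists y p, ~ R (shift y ** p) (y ** p).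
Proof.
move=> xx; apply: contrapT => no; apply: xx.
have le y p : R (shift y ** p) (y ** p).
  by apply: contrapT => yp; apply: no; exists y, p.
apply: fR => p; split; first exact: le.
have dec i : R (iter i.+1 (@shift A) x ** p) (shift x ** p).
  elim: i => [|i IH]; first exact: po_refl.
  by apply: (po_trans poR _ IH); exact: le.
by rewrite -{1}(per x); exact: dec.
Qed.

(** If [y^ll p] lies strictly above [y p], then [y^ll y^r] moves [y p] up, while by [shift_cover] no
    shift of it jumps past a larger point. Joining all shifts makes it invertible. *)
Lemma exists_successor x : shift x <> x -> exists T : A,
  [/\ shift T = T, forall p q, ~ R q p -> R (T ** p) q & ~ R T one].
Proof.
move=> /shift_moves[y [p yp]].
pose z := join (shift y ** radj y) one; exists (tau_ z).
have zT : z <== tau_ z by have /(bjoin_le lpA)/(_ 0 (leq0n k)) := lp_refl lpA (tau_ z).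
have z1 : one <== z by exact: lp_joinr.
split; first exact: tau_inv.
- move=> r q qr; apply: (po_bjoin_le lpA poR) => i.
  rewrite iter_shiftU // iter_shiftM // iter_shift_radj //.
  rewrite (iter_shift_fix i (shift1 lpA)) -iterSr iterS lp_mulUr // (lp_mul1 lpA) -(lp_mulA lpA).
  apply: po_join => //; last exact: po_notle.
  apply: shift_cover => h; apply: qr; apply: (po_trans poR h).
  rewrite (lp_mulA lpA) -{2}(lp_mul1 lpA r); apply: po_mulr => //.
  exact: radj_le1_ax.
(* If [T] did not move the base point up, its central power [T^(k+1)] would not move [y p] up
   either, although it lies above [y^ll y^r]. *)
- move=> T1; apply: yp.
  have Tn n : R (pow (tau_ z) n) one.
    elim: n => [|n IH]; first exact: (po_refl poR).
    rewrite powS; apply: (po_trans poR (b := tau_ z)) => //.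
    by rewrite -[X in R _ X](lp_mulr1 lpA (tau_ z)); exact: po_mull.
  have TT : tau_ z <== pow (tau_ z) k.+1.
    rewrite powS -[X in X <== _](lp_mulr1 lpA (tau_ z)); apply: lp_mul2l => //.
    elim: {-1}k => [|n IH]; first exact: lp_refl.
    rewrite powS -[X in X <== _](lp_mul1 lpA one); apply: lp_mul2 => //.
    exact: (lp_trans lpA z1 zT).
  apply: (po_trans poR (b := z ** (y ** p))).
    apply: (po_trans poR (b := shift y ** radj y ** (y ** p))).
      rewrite -(lp_mulA lpA); apply: po_mull => //; rewrite (lp_mulA lpA).
      by rewrite -[X in R X _](lp_mul1 lpA p); apply: po_mulr => //; exact: radj_ge1_ax.
    by apply: po_mulr => //; exact: lp_joinl.
  apply: (po_trans poR (b := pow (tau_ z) k.+1 ** (y ** p))).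
    by apply: po_mulr => //; exact: (lp_trans lpA zT TT).
  rewrite pow_central ?tau_inv // -[X in R _ X](lp_mulr1 lpA (y ** p)).
  exact: po_mull.
Qed.

(** * Actions with a covering element [T] *)

Section Discrete.

Variable T : A.
Hypothesis TT : shift T = T.
Hypothesis Tcov : forall p q, ~ R q p -> R (T ** p) q.
Hypothesis T1 : ~ R T one.

Lemma T_strict_inv h : shift h = h -> ~ R (T ** h) h.
Proof.
by move=> hh; rewrite inv_comm // => /(po_inv_mul hh); rewrite inv_mulKl.
Qed.

(** Some [b^[j]] is at most [sigma_ b] at the base point, and each further shift raises this bound
    by one factor [T]. As [b^[k+1] = b], finitely many steps reach [b], and nothing lies strictly
    between consecutive steps. *)
Lemma sigma_reach b :
  exists n, R b (pow T n ** sigma_ b) /\ R (pow T n ** sigma_ b) b.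
Proof.
pose pt n := pow T n ** sigma_ b.
have ptS n : pt n.+1 = T ** pt n by rewrite /pt powS (lp_mulA lpA).
have ptT n : ~ R (pt n.+1) (pt n).
  rewrite ptS; apply: T_strict_inv.
  by rewrite (shiftM lpA) sigma_inv shift_pow_fix.
have step n x : R x (pt n) -> R (shift x) (pt n.+1).
  move=> xn; rewrite -(lp_mulr1 lpA (shift x)); apply: shift_cover.
  by rewrite (lp_mulr1 lpA) => /(po_trans poR) /(_ xn); exact: ptT.
have [j jk bj] : exists2 j, (j <= k)%N & R (iter j (@shift A) b) (pt 0%N).
  have := po_refl poR (sigma_ b); rewrite -{1}(lp_mulr1 lpA (sigma_ b)).
  move=> /(po_bmeet_prime lpA poR)[j jk]; rewrite (lp_mulr1 lpA) => bj.
  by exists j; rewrite // /pt (lp_mul1 lpA).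
have reach n : R (iter (n + j) (@shift A) b) (pt n) by elim: n => //= n; exact: step.
have : R b (pt (k.+1 - j)%N).
  by have := reach (k.+1 - j)%N; rewrite subnK ?per //; exact: leqW.
elim: (k.+1 - j)%N => [|n IH] bn.
  exists 0%N; split => //; rewrite (lp_mul1 lpA); apply: (po_le poR).
  by have /(le_bmeet lpA)/(_ 0 (leq0n k)) := lp_refl lpA (sigma_ b).
have [/IH//|/Tcov bn'] := EM (R b (pt n)).
by exists n.+1; split => //; rewrite -/(pt _) ptS.
Qed.

Lemma point_inv b : exists h, [/\ shift h = h, R b h & R h b].
Proof.
have [n [h1 h2]] := sigma_reach b; exists (pow T n ** sigma_ b); split => //.
by rewrite (shiftM lpA) sigma_inv shift_pow_fix.
Qed.

(** Invertible elements commute and reach every point, so agreement at the base point spreads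
    everywhere. *)
Lemma inv_eq g h : shift g = g -> shift h = h -> R g h -> R h g -> g = h.
Proof.
move=> gg hh gh hg; apply: fR => c; have [c' [cc c1 c2]] := point_inv c.
have half x y : shift x = x -> shift y = y -> R x y -> R (x ** c) (y ** c).
  move=> xx yy xy; apply: (po_trans poR (po_mull poR x c1)).
  apply: (po_trans poR _ (po_mull poR y c2)).
  by rewrite inv_comm // [y ** _]inv_comm //; exact: po_mull.
by split; exact: half.
Qed.

Lemma T_strict p : ~ R (T ** p) p.
Proof.
move=> Tp; have [h [hh ph hp]] := point_inv p; apply: (T_strict_inv hh).
exact: (po_trans poR (po_mull poR T hp) (po_trans poR Tp ph)).
Qed.

Lemma succP p q : ~ R q p <-> R (T ** p) q.
Proof.
by split=> [/Tcov//|Tp qp]; exact: (T_strict (po_trans poR Tp qp)).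
Qed.

(** As for translation by 1 in [FZ]: two adjunctions introduce two negations of the order, and each
    negation costs one factor [T]. *)
Lemma shift_T a : shift a = T ** a ** ladj T.
Proof.
have E q r : R (shift a ** q) r <-> R (T ** a ** ladj T ** q) r.
  rewrite -!(lp_mulA lpA) -succP -(po_ladjP lpA poR a) -(po_inv_mul TT) -succP.
  by rewrite /shift (po_ladjP lpA poR); split=> [qr|/contrapT].
apply: fR => q; split; first by apply/E; exact: po_refl.
by apply/E; exact: po_refl.
Qed.

End Discrete.

End Core.

(** * Embedding faithful actions into ordered groups *)

(** Bundled because commutativity of the invertible elements is a derived fact; the sort can then
    carry a [zmodType] structure. *)
Record abelian_group : Type := AbelianGroup {
  ag_sort :> Type;
  ag_add : ag_sort -> ag_sort -> ag_sort;
  ag_zero : ag_sort;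
  ag_opp : ag_sort -> ag_sort;
  ag_addA : associative ag_add;
  ag_addC : commutative ag_add;
  ag_add0 : left_id ag_zero ag_add;
  ag_addN : left_inverse ag_zero ag_opp ag_add }.

HB.instance Definition _ (G : abelian_group) := gen_eqMixin (ag_sort G).
HB.instance Definition _ (G : abelian_group) := gen_choiceMixin (ag_sort G).
HB.instance Definition _ (G : abelian_group) :=
  GRing.isZmodule.Build (ag_sort G)
    (@ag_addA G) (@ag_addC G) (@ag_add0 G) (@ag_addN G).

Section InvertibleGroup.

Variable A : algebra.
Hypothesis lpA : is_lpregroup A.
Hypothesis commA : forall g h : A,
  shift g = g -> shift h = h -> g ** h = h ** g.

Definition invertible : Type := {h : A | shift h = h}.

Lemma inv_fixM (g h : invertible) : shift (sval g ** sval h) = sval g ** sval h.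
Proof. by rewrite shiftM // (svalP g) (svalP h). Qed.

Definition inv_mul (g h : invertible) : invertible :=
  exist _ (sval g ** sval h) (inv_fixM g h).

Definition inv_one : invertible := exist _ one (shift1 lpA).

Definition inv_inv (g : invertible) : invertible :=
  exist _ (ladj (sval g)) (shift_ladj_fix (svalP g)).

Lemma inv_mulA : associative inv_mul.
Proof. by move=> f g h; apply: eq_exist; rewrite /= lp_mulA. Qed.

Lemma inv_mulC : commutative inv_mul.
Proof. by move=> g h; apply: eq_exist; exact: commA (svalP g) (svalP h). Qed.

Lemma inv_mul1 : left_id inv_one inv_mul.
Proof. by case=> g gg; apply: eq_exist; rewrite /= lp_mul1. Qed.

Lemma inv_mulN : left_inverse inv_one inv_inv inv_mul.
Proof. by move=> [g gg]; apply: eq_exist; rewrite /= inv_mulKl. Qed.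

Definition inv_group : abelian_group :=
  AbelianGroup inv_mulA inv_mulC inv_mul1 inv_mulN.

End InvertibleGroup.

Section CoreTheorem.
Local Open Scope ring_scope.
Import Order.TTheory GRing.Theory Num.Theory.

Variables (A : algebra) (R : A -> A -> Prop) (k : nat).
Hypothesis lpA : is_lpregroup A.
Hypothesis poR : point_order R.
Hypothesis fR : faithful R.
Hypothesis brk : forall x y z : A, one <== bracket k.+1 x y z.

Let commA := inv_comm lpA poR fR brk.
Let G : zmodType := inv_group lpA commA.
Implicit Types u v w : G.

Definition gval u : A := sval (u : invertible A).

Lemma gvalP u : shift (gval u) = gval u.
Proof. exact: (svalP (u : invertible A)). Qed.

Lemma gvalD u v : gval (u + v) = gval u ** gval v.
Proof. by []. Qed.

Lemma gval0 : gval 0 = one.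
Proof. by []. Qed.

Lemma gvalN u : gval (- u) = ladj (gval u).
Proof. by []. Qed.

Lemma gvalI u v : gval u = gval v -> u = v.
Proof. by case: u v => [g gg] [h hh] /= gh; exact: eq_exist. Qed.

Definition gnn u : Prop := R one (gval u).

Lemma gnnB u v : gnn (v - u) <-> R (gval u) (gval v).
Proof.
by rewrite /gnn addrC gvalD gvalN -(po_inv_mul lpA poR (gvalP u)) lp_mulr1.
Qed.

Lemma gnnD u v : gnn u -> gnn v -> gnn (u + v).
Proof.
move=> un vn; apply: (po_trans poR un); rewrite -[X in R X _](lp_mulr1 lpA).
exact: po_mull.
Qed.

Lemma gnn_total u : gnn u \/ gnn (- u).
Proof.
have := po_total poR one (gval u); rewrite /gnn => -[|h]; [by left|right].
by rewrite gvalN -(lp_mulr1 lpA (ladj _)) -(po_inv_mul lpA poR (gvalP u)) lp_mulr1.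
Qed.

Variable val : var -> A.

(** * The case in which every element is invertible *)

Section AllInvertible.

Hypothesis shift_id : forall x : A, shift x = x.

Let inj x : G := (exist _ x (shift_id x) : invertible A).
Let G2 : zmodType := (G * int)%type.

Lemma all_inv_anti x y : R x y -> R y x -> x = y.
Proof.
by move=> xy yx; apply: fR => c; rewrite !(commA _ (shift_id c)) //; split;
  exact: po_mull.
Qed.

Lemma oppr0_eq u : - u = 0 -> u = 0.
Proof. by move=> u0; rewrite -[u]opprK u0 oppr0. Qed.

(** The ordered group [G] may lack a least positive element; the lexicographic product with [int]
    supplies [(0, 1)]. *)
Definition lex_nn (p : G2) : Prop := gnn p.1 /\ p.1 <> 0 \/ p.1 = 0 /\ 0 <= p.2.

Lemma gnn_anti_all u : gnn u -> gnn (- u) -> u = 0.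
Proof.
move=> un; rewrite -sub0r gnnB => u1; apply: gvalI; exact: all_inv_anti.
Qed.

Lemma lex_discrete : is_discrete lex_nn (fun _ _ => True) k.+1 (0, 1).
Proof.
split=> //.
- move=> [u m] [v n] [[/= un u0]|[/= -> m0]] [[/= vn v0]|[/= -> n0]].
  + left; split; first exact: gnnD.
    move=> uv; apply: u0; apply: gnn_anti_all => //.
    by rewrite (addr0_eq uv).
  + by left; rewrite /= addr0.
  + by left; rewrite /= add0r.
  + by right; rewrite /= addr0; split=> //; exact: addr_ge0.
- move=> [u m] [[/= un u0]|[/= -> m0]].
    case=> -[/= u1 u2]; first by case: u0; exact: gnn_anti_all.
    by case: u0; exact: oppr0_eq.
  case=> -[/= u1 u2]; first by rewrite oppr0 in u2.
  by congr (_, _); apply/eqP; rewrite eq_le m0 andbT -oppr_ge0.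
- move=> [u m]; have [->|u0] := EM (u = 0).
    have [m0|m0] := leP 0 m; first by left; right.
    by right; right; rewrite /= oppr0; split=> //; rewrite oppr_ge0 ltW.
  have [un|un] := gnn_total u; first by left; left.
  by right; left; split=> //= /oppr0_eq.
- by move=> u; exists 0.
- by right.
- move=> [u m] [[/= un u0]|[/= -> m0]] um.
    by left; split; rewrite /= subr0.
  right; split; rewrite /= ?subr0 //.
  have : m <> 0 by move=> m1; apply: um; rewrite m1.
  by lia.
Qed.

Lemma lex_nn0 u : lex_nn (u, 0) <-> gnn u.
Proof.
split=> [[[]|[/= -> _]]//|un]; first exact: po_refl.
by have [->|u0] := EM (u = 0); [right|left].
Qed.

Lemma all_invertible_approx a b : satisfies (Fn k.+1) (a, b) ->
  eval val a = eval val b.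
Proof.
move=> ab; pose I t (p : G2) : G2 := (p.1 + inj (eval val t), p.2).
have IB s t p : I t p - I s p = (inj (eval val t) - inj (eval val s), 0).
  by apply: injective_projections; rewrite /= ?subrr // opprD addrACA subrr add0r.
have IBP s t p : lex_nn (I t p - I s p) <-> R (eval val s) (eval val t).
  by rewrite IB lex_nn0 gnnB.
have injN x y : inj x = inj y -> x = y by move=> /(congr1 gval).
suff /(congr1 fst)/addrI/injN : I a 0 = I b 0 by [].
apply: (interp_approx lex_discrete) ab => //.
- move=> x; exists (inj (val x), 0), (fun=> 0) => p m _.
  by rewrite mulr0z addr0; apply: injective_projections; rewrite //= addr0.
- move=> t p q; rewrite /I /=.
  suff -> : I t q - I t p = q - p by [].
  by apply: injective_projections; rewrite //= opprD addrACA subrr addr0.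
- move=> s t p; split=> /IBP st; congr (_, _); congr (_ + inj _) => /=;
    apply: all_inv_anti; try (by apply: po_meet => //; exact: po_refl);
    by apply: (po_le poR); (exact: lp_meetl || exact: lp_meetr).
- move=> s t p; split=> /IBP st; congr (_, _); congr (_ + inj _) => /=;
    apply: all_inv_anti; try (by apply: po_join => //; exact: po_refl);
    by apply: (po_le poR); (exact: lp_joinl || exact: lp_joinr).
- move=> s t p; apply: injective_projections => //=; rewrite -[RHS]addrA.
  by apply: (congr1 (fun w : G => p.1 + w)); rewrite addrC; apply: gvalI.
- case=> u m; apply: injective_projections => //=.
  by rewrite -[u in RHS]addr0; apply: (congr1 (fun w : G => u + w)); apply: gvalI.
- move=> t p q; suff -> : q - I (tladj t) p = I t q - p by [].
  have E : inj (eval val (tladj t)) = - inj (eval val t) by apply: gvalI.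
  by apply: injective_projections; rewrite //= E opprB addrA addrAC.
- move=> t p q; suff -> : p - I t q = I (tradj t) p - q by [].
  have E : inj (eval val (tradj t)) = - inj (eval val t).
    apply: gvalI; rewrite gvalN /=.
    by rewrite -{1}(shift_id (eval val t)) /shift lp_ladjK.
  by apply: injective_projections; rewrite //= E opprD addrA addrAC.
Qed.

End AllInvertible.

(** * The case of a covering element *)

Section Discrete.

Variable T : A.
Hypothesis TT : shift T = T.
Hypothesis Tcov : forall p q, ~ R q p -> R (T ** p) q.
Hypothesis T1 : ~ R T one.

Let TG : G := (exist _ T TT : invertible A).

Definition central u : Prop := forall a, gval u ** a = a ** gval u.

Lemma centralD u v : central u -> central v -> central (u + v).
Proof. by move=> uc vc a; rewrite gvalD -lp_mulA // vc lp_mulA // uc lp_mulA. Qed.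

Lemma centralN u : central u -> central (- u).
Proof.
move=> uc a; have uu := gvalP u; rewrite gvalN.
rewrite -[LHS](lp_mulr1 lpA) -(inv_mulV lpA uu) lp_mulA // -(lp_mulA lpA _ a).
by rewrite -uc !lp_mulA // inv_mulKl // lp_mul1.
Qed.

Lemma eqv_eq u v : R (gval u) (gval v) -> R (gval v) (gval u) -> u = v.
Proof.
move=> uv vu; apply: gvalI.
exact: (inv_eq lpA poR fR brk TT Tcov T1 (gvalP u) (gvalP v)).
Qed.

Lemma gval_Tz (n : nat) : gval (TG *~ n) = pow T n.
Proof. by elim: n => // n IH; rewrite intS mulrzDr mulr1z gvalD IH. Qed.

(** Residues exist by [conj_is_shift], because [shift] is conjugation by [T]. They are taken modulo
    [k.+1] because [T^(k+1)] is central. *)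
Lemma T_discrete :
  is_discrete gnn (fun u m => central (u - TG *~ m)) k.+1 TG.
Proof.
split=> //.
- exact: gnnD.
- by move=> u un; rewrite -sub0r gnnB => u1; exact: eqv_eq.
- exact: gnn_total.
- move=> u v m n uc vc; rewrite mulrzDr opprD addrACA; exact: centralD.
- by move=> u m uc; rewrite mulrNz -opprD; exact: centralN.
- move=> u; have [c cP] := conj_is_shift lpA poR fR brk (gvalP u).
  exists c => a; have shiftE n x :
      iter n (@shift A) x = gval (TG *~ n) ** x ** gval (- (TG *~ n)).
    elim: n => [|n IH]; first by rewrite mulr0z oppr0 gval0 lp_mulr1 // lp_mul1.
    rewrite iterS IH (shift_T lpA poR fR brk TT Tcov T1) intS mulrzDr mulr1z.
    rewrite gvalD [- (TG + _)]opprD [- TG + _]addrC gvalD.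
    by rewrite !lp_mulA.
  have E : gval (TG *~ c - u) ** a ** gval (u - TG *~ c) = a.
    by rewrite -[RHS](cP a) shiftE /conjugate !gvalD (gvalN u) !(lp_mulA lpA).
  rewrite -(opprB u (TG *~ c)) gvalN in E; have ww := gvalP (u - TG *~ c).
  move: (gval _) E ww => w E ww.
  by rewrite -{1}E !(lp_mulA lpA) inv_mulV // (lp_mul1 lpA).
- rewrite sub0r; apply: centralN => a; rewrite gval_Tz; exact: pow_central TT.
- by rewrite mulr1z subrr => a; rewrite gval0 lp_mul1 // lp_mulr1.
- by case: (po_total poR one T) => // /T1.
- by move=> T0; apply: T1; rewrite -[T]/(gval TG) T0; exact: po_refl.
- move=> u un u0; rewrite gnnB /= -(lp_mulr1 lpA T); apply: Tcov => u1.
  by apply: u0; apply: eqv_eq.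
Qed.

(** Transitivity of the invertible elements turns the action on points into maps of [G]. *)
Lemma act_exists t u : exists w,
  R (gval w) (eval val t ** gval u) /\ R (eval val t ** gval u) (gval w).
Proof.
have [h [hh h1 h2]] := point_inv lpA poR fR brk TT Tcov T1 (eval val t ** gval u).
by exists (exist _ h hh : invertible A).
Qed.

Definition act t u : G := projT1 (cid (act_exists t u)).

Lemma actP t u : R (gval (act t u)) (eval val t ** gval u) /\
  R (eval val t ** gval u) (gval (act t u)).
Proof. by rewrite /act; case: cid. Qed.

Lemma act_le t u v : gnn (v - act t u) <-> R (eval val t ** gval u) (gval v).
Proof.
by rewrite gnnB; have [h1 h2] := actP t u; split; exact: (po_trans poR).
Qed.

Lemma act_ge t u v : gnn (act t u - v) <-> R (gval v) (eval val t ** gval u).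
Proof.
by rewrite gnnB; have [h1 h2] := actP t u; split=> h; exact: (po_trans poR h).
Qed.

Lemma act_uniq t u w : R (gval w) (eval val t ** gval u) ->
  R (eval val t ** gval u) (gval w) -> act t u = w.
Proof.
have [h1 h2] := actP t u => h3 h4.
by apply: eqv_eq; [exact: (po_trans poR h1)|exact: (po_trans poR h3)].
Qed.

Lemma discrete_approx a b : satisfies (Fn k.+1) (a, b) ->
  R (eval val a) (eval val b).
Proof.
move=> ab; suff ab0 : act a 0 = act b 0.
  have [_ h1] := actP a 0; have [h2 _] := actP b 0.
  rewrite -ab0 in h2; rewrite -(lp_mulr1 lpA (eval val a)).
  by rewrite -(lp_mulr1 lpA (eval val b)); exact: (po_trans poR h1 h2).
apply: (interp_approx T_discrete) ab => //.
(* The translation part is [sigma] of the value of [x], and [e m] counts the [T]-steps from it at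
   [T *~ m]. The factor [T *~ m], fixed by [shift], comes out of [sigma]. *)
- move=> x; pose s : G := exist _ _ (sigma_inv lpA brk (val x)) : invertible A.
  have /choice[e eP] : forall m : int, exists n : nat,
      R (val x ** gval (TG *~ m)) (gval (TG *~ n + s + TG *~ m)) /\
      R (gval (TG *~ n + s + TG *~ m)) (val x ** gval (TG *~ m)).
    move=> m.
    have [n] := sigma_reach lpA poR fR brk TT Tcov T1 (val x ** gval (TG *~ m)).
    suff -> : bmeet (fun j => iter j (@shift A) (val x ** gval (TG *~ m))) k =
        gval (s + TG *~ m) by exists n; rewrite -addrA gvalD gval_Tz.
    rewrite gvalD /= bmeet_mulr //; apply: eq_bmeet => j.
    by rewrite iter_shiftM // (iter_shift_fix j (gvalP (TG *~ m))).
  exists s, (fun m => (e m)%:Z) => u m uc; have [e1 e2] := eP m.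
  (* The central element [u - TG *~ m] carries the computation at [TG *~ m] to [u]. *)
  have E : gval (u + s + TG *~ e m) =
      gval (u - TG *~ m) ** gval (TG *~ e m + s + TG *~ m).
    rewrite -gvalD; congr gval.
    by rewrite [TG *~ e m + s + _]addrC addrA subrK [TG *~ e m + s]addrC addrA.
  have E2 : val x ** gval u = gval (u - TG *~ m) ** (val x ** gval (TG *~ m)).
    by rewrite lp_mulA // uc -lp_mulA // -gvalD subrK.
  by apply: act_uniq; rewrite E /= E2; exact: po_mull.
- move=> t u v /gnnB uv; apply/act_ge; have [h1 h2] := actP t u.
  by apply: (po_trans poR h1); exact: po_mull.
- move=> s t u; have [s1 s2] := actP s u; have [t1 t2] := actP t u.
  split=> /gnnB st; apply: act_uniq; rewrite /= lp_mulIr //.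
  + apply: po_meet => //; exact: (po_trans poR st).
  + by apply: (po_trans poR _ s2); apply: (po_le poR); exact: lp_meetl.
  + apply: po_meet => //; exact: (po_trans poR st).
  + by apply: (po_trans poR _ t2); apply: (po_le poR); exact: lp_meetr.
- move=> s t u; have [s1 s2] := actP s u; have [t1 t2] := actP t u.
  split=> /gnnB st; apply: act_uniq; rewrite /= lp_mulUr //.
  + by apply: (po_trans poR t1); apply: (po_le poR); exact: lp_joinr.
  + apply: po_join => //; exact: (po_trans poR s2).
  + by apply: (po_trans poR s1); apply: (po_le poR); exact: lp_joinl.
  + apply: po_join => //; exact: (po_trans poR t2).
- move=> s t u; have [s1 s2] := actP s (act t u); have [t1 t2] := actP t u.
  apply: act_uniq; rewrite /= -lp_mulA //.
    by apply: (po_trans poR s1); exact: po_mull.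
  by apply: (po_trans poR _ s2); exact: po_mull.
- by move=> u; apply: act_uniq; rewrite /= lp_mul1 //; exact: po_refl.
- by move=> t u v; rewrite act_le act_ge /=; exact: po_ladjP.
- by move=> t u v; rewrite act_le act_ge /= (po_radjP lpA poR).
Qed.

End Discrete.

Lemma approx_Fn a b : satisfies (Fn k.+1) (a, b) -> R (eval val a) (eval val b).
Proof.
move=> ab; have [shift_id|] := EM (forall x : A, shift x = x).
  by rewrite (all_invertible_approx shift_id ab); exact: po_refl.
move=> /existsNP[x /(exists_successor lpA poR fR brk)[T [TT Tcov T1]]].
exact: discrete_approx TT Tcov T1 _ _ ab.
Qed.

End CoreTheorem.

(** * The variety generated by the F_k(Z) *)

Lemma hom_bracket (A B : algebra) (f : A -> B) k x y z :
  is_hom f -> f (bracket k x y z) = bracket k (f x) (f y) (f z).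
Proof.
move=> [fI fU fM f1 fl fr].
have fS n a : f (iter n (@shift A) a) = iter n (@shift B) (f a).
  by elim: n => //= n <-; rewrite /shift !fl.
have fP n a : f (pow a n) = pow (f a) n by elim: n => //= n <-; rewrite fM.
have fB n : f (bmeet (fun j => iter j (@shift A) y) n) =
    bmeet (fun j => iter j (@shift B) (f y)) n.
  by elim: n => // n IH; rewrite [LHS]fI IH fS.
by rewrite /bracket fI !fM !fl fS !fP fB.
Qed.

(** A failing inequality is separated by some action. There a single bracket [k] is valid, and the
    faithful quotient is approximated by F_k(Z). That [k] depends on the action, hence the
    assumption for all of [S]. *)
Lemma DLP_le_of_Fn (S : {fset nat}) (A : algebra) (v : var -> A) a b :
  S != fset0 -> (forall k, k \in S -> (0 < k)%N) ->
  DLP A -> satisfies A (join_equation S) ->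
  (forall k, k \in S -> satisfies (Fn k) (a, b)) -> eval v a <== eval v b.
Proof.
move=> S0 Spos DA AS ab; apply: contrapT => nle; have lpA := DA.1.
have [R [poR nR]] := point_order_exists DA nle; apply: nR.
have [k kS brk] := join_equation_bracket S0 Spos lpA AS poR.
have pi_hom := quot_pi_hom lpA poR; have lpQ := (quot_DLP lpA poR DA).1.
have k0 := Spos _ kS; have abk := ab _ kS; case: k {kS} brk k0 abk => // k brk _ abk.
have bracketQ (x y z : quot_algebra R) : one <== bracket k.+1 x y z.
  rewrite -(quot_reprK x) -(quot_reprK y) -(quot_reprK z) -(hom_bracket _ _ _ _ pi_hom).
  rewrite /le -(hom_one pi_hom) -(hom_meet pi_hom).
  apply: (quot_piP poR _ _).2 => c; split.
    rewrite lp_mulIr // lp_mul1 //; apply: po_meet => //; exact: po_refl.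
  by apply/(po_le poR)/lp_mul2r/lp_meetl.
have := approx_Fn lpQ (quot_point_order lpA poR) (@quot_faithful _ _ lpA poR) bracketQ
  (quot_pi R \o v) abk.
by rewrite -!(eval_hom _ _ pi_hom) quot_orderE.
Qed.

Lemma eval_foldl_tjoin_ge (A : algebra) (v : var -> A) (f : nat -> term) t s :
  is_lpregroup A -> eval v t <== eval v (foldl tjoin t [seq f k | k <- s]) /\
  forall k, k \in s -> eval v (f k) <== eval v (foldl tjoin t [seq f k | k <- s]).
Proof.
move=> lpA; elim: s t => [|i s IH] t /=; first by split=> //; exact: lp_refl.
have [h1 h2] := IH (tjoin t (f i)); split; first exact: lp_trans (lp_joinl lpA _ _) h1.
move=> k; rewrite inE => /orP[/eqP->|/h2//].
exact: lp_trans (lp_joinr lpA _ _) h1.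
Qed.

Lemma eval_tbigjoin_ge (A : algebra) (v : var -> A) (f : nat -> term) s k :
  is_lpregroup A -> k \in s ->
  eval v (f k) <== eval v (tbigjoin [seq f k | k <- s]).
Proof.
move=> lpA; case: s => // i s.
have [h1 h2] := eval_foldl_tjoin_ge v f (f i) s lpA.
by rewrite inE => /orP[/eqP->|/h2].
Qed.

(** * Validity of the equation in F_k(Z) *)

Section FnEquation.
Local Open Scope ring_scope.
Import Order.TTheory GRing.Theory Num.Theory.

Lemma periodic_mulz (f : int -> int) (n : nat) :
  (forall x, f (x + n%:Z) = f x + n%:Z) ->
  forall c x, f (x + n%:Z * c) = f x + n%:Z * c.
Proof.
move=> fn; have pos x (m : nat) : f (x + n%:Z * m%:Z) = f x + n%:Z * m%:Z.
  elim: m => [|m IH]; first by rewrite mulr0 !addr0.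
  by rewrite intS mulrDr mulr1 (addrC n%:Z) !addrA fn IH.
case=> m x; first exact: pos.
apply: (addIr (n%:Z * m.+1%:Z)); rewrite -pos NegzE -!addrA mulrN addNr !addr0.
by [].
Qed.

Lemma sval_iter_shift n j (f : Fn n) :
  sval (iter j (@shift (Fn n)) f) = iter j (@shift FZ) (sval f).
Proof. by elim: j => //= j <-. Qed.

Lemma Fn_periodic k (f : Fn k.+1) : iter k.+1 (@shift (Fn k.+1)) f = f.
Proof.
apply: sval_subalgebra_inj; rewrite sval_iter_shift; apply: FZ_ext => x.
by rewrite FZ_iter_shiftE -(is_FnP _ _).1 ?subrK //; exact: svalP.
Qed.

(** An [h] fixed by [shift] is translation by some [c]. Its power is translation by [(k+1) c], which
    commutes with maps of period [k+1]. *)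
Lemma Fn_pow_central k (h x : Fn k.+1) : shift h = h ->
  pow h k.+1 ** x = x ** pow h k.+1.
Proof.
move=> hh; pose c := sval (sval h) 0.
have hS m : sval (sval h) m = sval (sval h) (m - 1) + 1.
  by rewrite -[in LHS]hh; exact: FZ_shiftE.
have hN (n : nat) : sval (sval h) n%:Z = n%:Z + c /\ sval (sval h) (- n%:Z) = - n%:Z + c.
  elim: n => [|n [IH1 IH2]]; first by rewrite oppr0 add0r.
  split.
    by rewrite hS (_ : n.+1%:Z - 1 = n%:Z) ?IH1; lia.
  by have := hS (- n%:Z); rewrite IH2 (_ : - n%:Z - 1 = - n.+1%:Z); lia.
have hE m : sval (sval h) m = m + c.
  by case: m => n; [case: (hN n)|rewrite NegzE; case: (hN n.+1)].
have pE n m : sval (sval (pow h n)) m = m + n%:Z * c.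
  elim: n m => [|n IH] m; first by rewrite mul0r addr0.
  by rewrite powS /= hE IH intS mulrDl mul1r -addrA (addrC c).
move: (pow h k.+1) (pE k.+1) => P PE.
apply: sval_subalgebra_inj; apply: FZ_ext => m; rewrite /= !PE.
rewrite (periodic_mulz (f := sval (sval x))) //.
by apply/is_FnP; exact: svalP.
Qed.

(** Periodicity and centrality reduce both halves to [1 <= a a^l]. *)
Lemma Fn_bracket k (x y z : Fn k.+1) : one <== bracket k.+1 x y z.
Proof.
have lp := (Fn_DLP k.+1).1; have per := @Fn_periodic k.
apply: lp_glb => //; first by rewrite per; exact: ladj_ge1_ax.
set s := bmeet _ _; have ss : shift s = s by exact: bmeet_shift_fix.
rewrite Fn_pow_central // -(lp_mulA lp x) inv_mulV //; last exact: shift_pow_fix.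
by rewrite lp_mulr1 //; exact: ladj_ge1_ax.
Qed.

End FnEquation.

Lemma Fn_join_equation (S : {fset nat}) k : (0 < k)%N -> k \in S ->
  satisfies (Fn k) (join_equation S).
Proof.
case: k => // k _ kS v; have lp := (Fn_DLP k.+1).1.
apply: (lp_trans lp (b := eval v (summand k.+1))); last exact: eval_tbigjoin_ge.
rewrite eval_summand //; set w := v (vw _).
apply: (lp_trans lp (ladj_ge1_ax lp w)); apply: lp_mul2r => //.
by rewrite -{1}(lp_mulr1 lp w); apply: lp_mul2l => //; exact: Fn_bracket.
Qed.

Theorem corollary6p24 (S : {fset nat}) (S_neq0 : S != fset0)
    (S_pos : forall k : nat, k \in S -> (0 < k)%N) :
  generated_variety [set Fn k | k in [set` S]] =
  DLP `&` models [set join_equation S].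
Proof.
apply/seteqP; split=> [A AV|A [DA AS] V [[E ->] KE]].
  apply: AV; split; first exact: DLP_models_variety.
  move=> _ [k /= kS <-]; split; first exact: Fn_DLP.
  by move=> _ ->; apply: Fn_join_equation => //; exact: S_pos.
have {}AS : satisfies A (join_equation S) by exact: AS.
(* An arbitrary defining equation of a variety containing the F_k(Z) is obtained as two
   inequalities. *)
move=> [a b] Eab v /=.
have Fab k : k \in S -> satisfies (Fn k) (a, b).
  by move=> kS; apply: (KE (Fn k)) => //; exists k.
apply: (lp_anti DA.1); first exact: (DLP_le_of_Fn _ S_neq0 S_pos DA AS Fab).
apply: (DLP_le_of_Fn _ S_neq0 S_pos DA AS) => k kS w.
exact/esym/(Fab k kS).
Qed.
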